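(* There exists an absolute constant $c$ such that, for every integer $L\geq 1$, every real number $R\geq 2$ and every nonzero polynomial $P(z,w)\in\mathbf{C}[z,w]$ of degree at most $L$ in each variable, the function $z\mapsto P(z,G(z))$ has at most $cL(L+R)\log(L+R)$ zeros (counted with multiplicity) in the disc $\{z\in\mathbf{C}: |z|\leq R\}$.
   Context: $G(z)=1/\Gamma(z)$, where $\Gamma$ is Euler's Gamma function; $G$ is an entire function on $\mathbf{C}$ (with value $0$ at the non-positive integers). An absolute constant is one that does not depend on $L$, $R$ or $P$. *)

(* Defs.v *)
From HB Require Import structures.
From mathcomp Require Import all_boot all_order all_algebra.
From mathcomp Require Import complex.
From mathcomp Require Import all_classical all_reals all_analysis.

Set Implicit Arguments.
Unset Strict Implicit.
Unset Printing Implicit Defensive.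

Import Order.TTheory GRing.Theory Num.Theory.
Import numFieldNormedType.Exports.

Local Open Scope classical_set_scope.
Local Open Scope ring_scope.
Local Open Scope complex_scope.

(* R[i] receives its topology (that of the norm `|z|) and its structure of
   normed space over itself through the regular-module alias R[i]^o. In
   particular, [derivable g z 1] for g : R[i]^o -> R[i]^o is complex
   differentiability at z. *)

Definition cexp (R : realType) (z : R[i]) : R[i] :=
  (expR (complex.Re z) * cos (complex.Im z))
    +i* (expR (complex.Re z) * sin (complex.Im z)).

(* Euler's definition of the Gamma function, valid for every z which is not a
   non-positive integer:
     Gamma z = lim_n n! n^z / (z (z + 1) ... (z + n)),  n^z = exp (z ln n). *)
Definition Gamma_seq (R : realType) (z : R[i]) (n : nat) : R[i]^o :=
  n`!%:R * cexp (z * (ln (n%:R : R))%:C) / \prod_(k < n.+1) (z + k%:R).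

Definition Gamma (R : realType) (z : R[i]) : R[i] :=
  lim (Gamma_seq z n @[n --> \oo]).

Definition rGamma (R : realType) (z : R[i]) : R[i] :=
  if `[< exists k : nat, z = - k%:R >] then 0 else (Gamma z)^-1.

Definition holomorphic_at (R : realType) (g : R[i]^o -> R[i]^o) (a : R[i]^o) :
    Prop :=
  \forall z \near a, derivable g z 1.

(* f vanishes at a to order at least m *)
Definition vanishes_to_order (R : realType) (f : R[i] -> R[i]) (a : R[i])
    (m : nat) : Prop :=
  exists2 g : R[i]^o -> R[i]^o,
    holomorphic_at g a &
    \forall z \near (a : R[i]^o), f z = (z - a) ^+ m * g z.

(* The multiplicity of a zero is the largest m such that f vanishes there to
   order at least m. Bounding the sum of all admissible orders over all finite
   sets of distinct points is therefore bounding the number of zeros with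
   multiplicity; no bound N exists when f has infinitely many zeros in the disc
   or vanishes identically near one of its points. *)
Definition at_most_zeros_in_disc (R : realType) (f : R[i] -> R[i]) (r N : R) :
    Prop :=
  forall (s : seq R[i]) (m : R[i] -> nat),
    uniq s ->
    (forall a, a \in s -> `|a| <= r%:C /\ vanishes_to_order f a (m a)) ->
    ((\sum_(a <- s) m a)%N)%:R <= N.

(* A polynomial P(z, w) is an element of C[z][w]: P`_j is the coefficient of
   w^j, a polynomial in z. *)
Definition bidegree_le (R : realType) (L : nat) (P : {poly {poly R[i]}}) :
    Prop :=
  (size P <= L.+1)%N /\ forall j : nat, (size (P`_j)%R <= L.+1)%N.

Definition eval2 (R : realType) (P : {poly {poly R[i]}}) (z w : R[i]) : R[i] :=
  P.[w%:P].[z].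

(* Main.v *)
Require Import Defs.
From mathcomp Require Import all_boot all_order all_algebra.
From mathcomp Require Import complex.
From mathcomp Require Import all_classical all_reals all_analysis.
From mathcomp Require Import qpoly cyclic separable cyclotomic.
From mathcomp Require Import ring lra.

(** The function F z = P(z, 1/Gamma(z)) is entire, and two estimates decide how
  many zeros it can have in a disc.

  An entire function cannot have many zeros without growing. If F = W h, where
  the monic polynomial W carries the n zeros in question, the maximum principle
  for h on a large circle around a point z0 shows that the maximum of |F| on the
  circle is at least 3 ^ n |F z0| ([zeros_le_growth]).

  On the other hand |F| at a well chosen z0 of size O(L) already controls F on
  all large circles. On the negative real axis 1/Gamma vanishes at the integers,
  and between consecutive ones it has humps of alternating sign and factorially
  growing height. Hence, far enough to the left, every value w in [0, 1] is taken
  in every interval of length 2 ([rGamma_solutions]). Choosing w = 0, 1/L, ..., 1 and, for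
  each of them, L + 1 such solutions x gives (L + 1)^2 pairs (x, w) with
  P(x, w) = F x, well separated in both coordinates. Lagrange interpolation in
  each variable recovers P from these values: everywhere |P(z, w)| is bounded by
  an explicit factor times the largest |F x| ([eval2_max_sample]), and this x is
  the point z0. In particular F z0 is not 0.

  It remains to insert |1/Gamma(z)| <= exp (O(r log r)) for |z| <= r
  ([rGamma_growth]) on a circle of radius O(L + R): then 3 ^ n is at most
  exp (O(L (L + R) log (L + R))).

  The complex analysis is done with polynomials only. A function is called entire
  when polynomials approximate it uniformly on every disc. For a polynomial the
  mean value property over a circle is a finite sum over roots of unity
  ([poly_mean_value]), and it passes to the limit. Division by z - a at a zero a
  stays in the class ([entire_div]), again because the mean value property carries
  bounds on a circle to its centre. The function 1/Gamma belongs to the class as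
  the locally uniform limit of the reciprocals of the Euler products. *)

Set Implicit Arguments.
Unset Strict Implicit.
Unset Printing Implicit Defensive.

Import Order.TTheory GRing.Theory Num.Theory.
Import numFieldNormedType.Exports.
Import Normc.

Local Open Scope classical_set_scope.
Local Open Scope ring_scope.
Local Open Scope complex_scope.

(** * The modulus of a complex number *)

Section Modulus.
Variable K : realType.
Implicit Types (x y : K) (z w : K[i]).

Lemma normcE z : `|z| = (normc z)%:C.
Proof. by []. Qed.

Lemma normc_ge0 z : 0 <= normc z.
Proof. by rewrite -lecR -normcE normr_ge0. Qed.

Lemma normc_eq0 z : (normc z == 0) = (z == 0).
Proof. by rewrite -(inj_eq (@complexI K)) -normcE normr_eq0. Qed.

Lemma normc_gt0 z : (0 < normc z) = (z != 0).
Proof. by rewrite lt_neqAle normc_ge0 andbT eq_sym normc_eq0. Qed.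

Lemma normcR x : normc x%:C = `|x|.
Proof. by rewrite /normc /= expr0n /= addr0 sqrtr_sqr. Qed.

Lemma normcX z n : normc (z ^+ n) = normc z ^+ n.
Proof.
elim: n => [|n IH]; first by rewrite !expr0 normc1.
by rewrite !exprS normcM IH.
Qed.

Lemma normc_nat n : normc (n%:R : K[i]) = n%:R.
Proof. by rewrite -(rmorph_nat (@real_complex K)) normcR normr_nat. Qed.

Lemma normc_distC z w : normc (z - w) = normc (w - z).
Proof. by rewrite -normcN opprB. Qed.

Lemma le_normcB z w : normc (z - w) <= normc z + normc w.
Proof. by rewrite -(normcN w); exact: le_normcD. Qed.

Lemma le_normc_dist z w u : normc (z - u) <= normc (z - w) + normc (w - u).
Proof.
have -> : z - u = (z - w) + (w - u) by rewrite addrA subrK.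
exact: le_normcD.
Qed.

Lemma le_normc_shift z w : normc z <= normc w + normc (z - w).
Proof. by have := le_normcD w (z - w); rewrite addrC subrK addrC. Qed.

Lemma normc_sum (I : Type) (s : seq I) (P : pred I) (F : I -> K[i]) :
  normc (\sum_(i <- s | P i) F i) <= \sum_(i <- s | P i) normc (F i).
Proof.
elim/big_rec2: _ => [|i y z _ IH]; first by rewrite normc0.
by apply: le_trans (le_normcD _ _) _; rewrite lerD2l.
Qed.

Lemma normc_prod (I : Type) (s : seq I) (P : pred I) (F : I -> K[i]) :
  normc (\prod_(i <- s | P i) F i) = \prod_(i <- s | P i) normc (F i).
Proof.
elim/big_rec2: _ => [|i y z _ IH]; first exact: normc1.
by rewrite normcM IH.
Qed.

Lemma normc_i : normc ('i : K[i]) = 1.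
Proof. by rewrite /normc /= expr0n expr1n add0r sqrtr1. Qed.

Lemma normc_le_ReIm z : normc z <= `|complex.Re z| + `|complex.Im z|.
Proof.
have -> : z = (complex.Re z)%:C + 'i * (complex.Im z)%:C by rewrite -complexE.
apply: le_trans (le_normcD _ _) _; rewrite normcM normc_i !normcR /=.
by rewrite !(mul0r, mulr0, mul1r, addr0, subr0, add0r).
Qed.

Lemma Re_le_normc z : `|complex.Re z| <= normc z.
Proof. by rewrite -lecR -normcE normc_ge_Re. Qed.

Lemma Im_le_normc z : `|complex.Im z| <= normc z.
Proof.
have := Re_le_normc (z * 'i); rewrite ReiNIm normrN normcM normc_i mulr1.
by [].
Qed.

(** Completeness with a rate. It is stated for the rate B / (m + 1) because both
  limits taken below, in [entire_div] and for 1/Gamma, converge at that rate. *)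
Lemma complex_cauchy_limit (u : nat -> K[i]) (B : K) :
  (forall m n, (m <= n)%N -> normc (u n - u m) <= B / m.+1%:R) ->
  exists l, forall m, normc (l - u m) <= B / m.+1%:R.
Proof.
move=> uB.
have B0 : 0 <= B.
  by have := uB 0 0 (leqnn _); rewrite subrr normc0 divr1.
have Bsmall e : 0 < e -> exists N, forall n, (N <= n)%N -> B / n.+1%:R <= e.
  move=> e0; exists (Num.truncn (B / e)) => n Nn.
  rewrite ler_pdivrMr ?ltr0n // mulrC -ler_pdivrMr //.
  apply/ltW/(lt_le_trans (truncnS_gt _)).
  by rewrite ler_nat ltnS.
have cvgp (p : K[i] -> K) : (forall z w, p (z - w) = p z - p w) ->
    (forall z, `|p z| <= normc z) -> cvgn (p \o u).
  move=> pB ple; apply/cauchy_cvgP/cauchy_exP => e e0.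
  have e20 : 0 < e / 2 by rewrite divr_gt0.
  have [N HN] := Bsmall _ e20.
  exists (p (u N)); exists N => // n /= Nn.
  rewrite /ball /= distrC -pB; apply: le_lt_trans (ple _) _.
  apply: le_lt_trans (uB _ _ Nn) _; apply: le_lt_trans (HN _ (leqnn _)) _.
  by rewrite ltr_pdivrMr // ltr_pMr // ltr1n.
have cRe : cvgn (@complex.Re K \o u).
  by apply: cvgp Re_le_normc => -[a b] [c d].
have cIm : cvgn (@complex.Im K \o u).
  by apply: cvgp Im_le_normc => -[a b] [c d].
exists (limn (@complex.Re K \o u) +i* limn (@complex.Im K \o u)) => m.
apply/ler_addgt0Pr => e e0; have e20 : 0 < e / 2 by rewrite divr_gt0.
have /cvgrPdist_le/(_ _ e20)[N1 _ H1] := cRe.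
have /cvgrPdist_le/(_ _ e20)[N2 _ H2] := cIm.
pose n := maxn m (maxn N1 N2).
apply: le_trans (le_normc_dist _ (u n) _) _.
rewrite addrC; apply: lerD; first by apply: uB; exact: leq_maxl.
apply: le_trans (normc_le_ReIm _) _; rewrite [e]splitr; apply: lerD.
  have := H1 n; rewrite /= => /(_ _); case: (u n) => a b /=; apply.
  by rewrite /n; apply: leq_trans (leq_maxr _ _); exact: leq_maxl.
have := H2 n; rewrite /= => /(_ _); case: (u n) => a b /=; apply.
by rewrite /n; apply: leq_trans (leq_maxr _ _); exact: leq_maxr.
Qed.

End Modulus.
#[local] Arguments normc : simpl never.

(** * The mean value property of polynomials *)

Section PolynomialMeanValue.
Variable K : realType.
Local Notation C := K[i].
Implicit Types (a z w : C) (p q : {poly C}) (f g : C -> C) (r e M : K).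

Lemma prim_root_complex n : (0 < n)%N -> exists x : C, n.-primitive_root x.
Proof.
move=> n_gt0; pose p : {poly C} := 'X^n - 1.
have [s Dp] := closed_field_poly_normal p.
rewrite (monicP _) ?monicXnsubC // scale1r in Dp.
have sn1 : all n.-unity_root s.
  by apply/allP => x; rewrite -root_prod_XsubC -Dp.
have sz_s : (n < (size s).+1)%N.
  by rewrite -(size_prod_XsubC s id) -Dp size_XnsubC.
have [|x _ hx] := hasP (has_prim_root n_gt0 sn1 _ sz_s); last by exists x.
by rewrite -separable_prod_XsubC -Dp separable_Xn_sub_1 // pnatr_eq0 -lt0n.
Qed.

(** Averaging over the N-th roots of unity, for N larger than the degree, kills
  all Taylor coefficients at a except the constant one, so that p a is the mean of
  N values of p on the circle. *)
Lemma poly_mean_value p a r M : 0 <= r ->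
  (forall z, normc (z - a) = r -> normc p.[z] <= M) -> normc p.[a] <= M.
Proof.
move=> r0 pM; pose q := p \Po ('X + a%:P); pose N := (size q).+1.
have [x xprim] := prim_root_complex (ltn0Sn (size q)); rewrite -/N in xprim.
have qE z : q.[z] = p.[z + a] by rewrite horner_comp !hornerE.
have x1 : x ^+ N = 1 by apply: prim_expr_order.
have nx1 : normc x = 1.
  apply: (@pexpIrn _ N) => //; rewrite ?nnegrE ?normc_ge0 //.
  by rewrite -normcX x1 normc1 expr1n.
have qW z : q.[z] = \sum_(k < N) q`_k * z ^+ k.
  by rewrite (@horner_coef_wide _ N) // /N.
have sumq : \sum_(j < N) q.[r%:C * x ^+ j] = N%:R * p.[a].
  under eq_bigr do rewrite qW.
  rewrite exchange_big /= big_ord_recl /= [X in _ + X]big1 => [|k _].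
    under eq_bigr do rewrite expr0 mulr1.
    rewrite sumr_const card_ord addr0 mulr_natl -horner_coef0 qE add0r.
    by [].
  rewrite /bump /= add1n.
  under eq_bigr do rewrite exprMn mulrA -exprM mulnC exprM.
  rewrite -mulr_sumr; apply/eqP; rewrite mulf_eq0; apply/orP; right.
  have xk : x ^+ k.+1 - 1 != 0.
    rewrite subr_eq0 -(prim_order_dvd xprim) gtnNdvd //.
    by rewrite /N ltnS.
  rewrite -(mulrI_eq0 _ (mulfI xk)) -subrX1 -exprM mulnC exprM x1 expr1n.
  by rewrite subrr.
have : normc (N%:R * p.[a]) <= N%:R * M.
  rewrite -sumq; apply: le_trans (normc_sum _ _ _) _.
  rewrite mulr_natl -[N in _ *+ N]card_ord -sumr_const.
  apply: ler_sum => j _; rewrite qE; apply: pM.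
  by rewrite addrK normcM normcX nx1 expr1n mulr1 normcR ger0_norm.
by rewrite normcM normc_nat ler_pM2l // ltr0n.
Qed.
End PolynomialMeanValue.

(** * Entire functions as limits of polynomials *)

Section EntireFunctions.
Variable K : realType.
Local Notation C := K[i].
Implicit Types (a z w : C) (p q : {poly C}) (f g : C -> C) (r e M : K).

(** Over the complex numbers these are exactly the entire functions: truncated
  Taylor series give the approximants, and conversely locally uniform limits of
  polynomials are holomorphic. *)
Definition entire f := forall r e, 0 < e ->
  exists p, forall z, normc z <= r -> normc (f z - p.[z]) <= e.

Lemma poly_bounded p r : exists2 M, 0 < M &
  forall z, normc z <= r -> normc p.[z] <= M.
Proof.
exists (1 + \sum_(i < size p) normc p`_i * `|r| ^+ i) => [|z zr].
  rewrite ltr_wpDr // sumr_ge0 // => i _.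
  by rewrite mulr_ge0 ?normc_ge0 ?exprn_ge0.
rewrite horner_coef; apply: le_trans (normc_sum _ _ _) _.
apply: ler_wpDl => //; apply: ler_sum => i _.
rewrite normcM normcX ler_wpM2l ?normc_ge0 // lerXn2r ?nnegrE ?normc_ge0 //.
by apply: le_trans zr _; exact: ler_norm.
Qed.

Lemma entire_bounded f r : entire f -> exists2 M, 0 < M &
  forall z, normc z <= r -> normc (f z) <= M.
Proof.
move=> /(_ r 1 ltr01)[p pf]; have [M M0 pM] := poly_bounded p r.
exists (1 + M) => [|z zr]; first exact: addr_gt0.
rewrite -(subrK p.[z] (f z)); apply: le_trans (le_normcD _ _) _.
by apply: lerD; [exact: pf | exact: pM].
Qed.

Lemma entire_poly p : entire (horner p).
Proof. by move=> r e e0; exists p => z _; rewrite subrr normc0 ltW. Qed.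

Lemma entireD f g : entire f -> entire g -> entire (fun z => f z + g z).
Proof.
move=> fE gE r e e0; have e20 : 0 < e / 2 by rewrite divr_gt0.
have [p pf] := fE r _ e20; have [q qg] := gE r _ e20.
exists (p + q) => z zr; rewrite hornerD opprD addrACA [e]splitr.
by apply: le_trans (le_normcD _ _) _; rewrite lerD ?pf ?qg.
Qed.

Lemma entireM f g : entire f -> entire g -> entire (fun z => f z * g z).
Proof.
move=> fE gE r e e0.
have [A A0 fA] := entire_bounded r fE; have [B B0 gB] := entire_bounded r gE.
have eB : 0 < e / (2 * B) by rewrite divr_gt0 ?mulr_gt0.
have [p pf] := fE r _ eB.
have eA : 0 < e / (2 * (A + e / (2 * B))) by rewrite divr_gt0 ?mulr_gt0 ?addr_gt0.
have [q qg] := gE r _ eA.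
exists (p * q) => z zr; rewrite hornerM.
have -> : f z * g z - p.[z] * q.[z]
    = (f z - p.[z]) * g z + p.[z] * (g z - q.[z]) by ring.
apply: le_trans (le_normcD _ _) _; rewrite !normcM [e]splitr; apply: lerD.
  have -> : e / 2 = e / (2 * B) * B by field; rewrite gt_eqF.
  by apply: ler_pM; rewrite ?normc_ge0 ?pf ?gB.
have -> : e / 2 = (A + e / (2 * B)) * (e / (2 * (A + e / (2 * B)))).
  field; rewrite gt_eqF //= gt_eqF //.
  by rewrite addr_gt0 // mulr_gt0 // mulr_gt0.
apply: ler_pM; rewrite ?normc_ge0 ?qg //.
rewrite -(subKr (f z) p.[z]); apply: le_trans (le_normcB _ _) _.
by apply: lerD; rewrite ?fA ?pf.
Qed.

Lemma entire_ext f g : f =1 g -> entire f -> entire g.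
Proof.
move=> fg fE r e e0; have [p pf] := fE r e e0.
by exists p => z /pf; rewrite fg.
Qed.

Lemma entire_lim f : (forall r e, 0 < e -> exists2 g, entire g &
    forall z, normc z <= r -> normc (f z - g z) <= e) -> entire f.
Proof.
move=> fl r e e0; have e20 : 0 < e / 2 by rewrite divr_gt0.
have [g gE fg] := fl r _ e20; have [p pg] := gE r _ e20.
exists p => z zr; rewrite [e]splitr; apply: le_trans (le_normc_dist _ (g z) _) _.
by apply: lerD; [exact: fg | exact: pg].
Qed.

Lemma entire_continuous f a : entire f -> forall e, 0 < e ->
  exists2 d, 0 < d & forall z, normc (z - a) <= d -> normc (f z - f a) <= e.
Proof.
move=> fE e e0; have e30 : 0 < e / 3 by rewrite divr_gt0.
have [p pf] := fE (normc a + 1) _ e30.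
have /factor_theorem[q pq] : root (p - p.[a]%:P) a.
  by rewrite rootE !hornerE subrr.
have [M M0 qM] := poly_bounded q (normc a + 1).
exists (Num.min 1 (e / (3 * M))) => [|z].
  by rewrite lt_min ltr01 divr_gt0 // mulr_gt0.
rewrite le_min => /andP[za1 zae].
have zr : normc z <= normc a + 1.
  by apply: le_trans (le_normc_shift z a) _; rewrite lerD2l.
have -> : f z - f a = (f z - p.[z]) + (p.[z] - p.[a]) - (f a - p.[a]) by ring.
have -> : e = e / 3 + e / (3 * M) * M + e / 3 by field; rewrite gt_eqF.
apply: le_trans (le_normcB _ _) _; apply: lerD; last first.
  by apply: pf; rewrite lerDl.
apply: le_trans (le_normcD _ _) _; apply: lerD; first exact: pf.
have -> : p.[z] - p.[a] = (z - a) * q.[z].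
  by have /(congr1 (horner^~ z)) := pq; rewrite !hornerE mulrC.
by rewrite normcM ler_pM ?normc_ge0 ?qM.
Qed.

Lemma entire_mean_value f a r M : entire f -> 0 <= r ->
  (forall z, normc (z - a) = r -> normc (f z) <= M) -> normc (f a) <= M.
Proof.
move=> fE r0 fM; apply/ler_addgt0Pr => e e0.
have e20 : 0 < e / 2 by rewrite divr_gt0.
have [p pf] := fE (normc a + r) _ e20.
have pM : normc p.[a] <= M + e / 2.
  apply: (poly_mean_value r0) => z zr.
  rewrite -(subKr (f z) p.[z]); apply: le_trans (le_normcB _ _) _.
  apply: lerD; first exact: fM.
  by apply: pf; rewrite -zr le_normc_shift.
rewrite -(subrK p.[a] (f a)); apply: le_trans (le_normcD _ _) _.
have := pf a; rewrite lerDl => /(_ r0); lra.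
Qed.

(** Dividing p - p(a) by z - a for approximants p of f gives polynomials close to
  f z / (z - a) wherever |z - a| >= 1. By the mean value property they are then
  also close to each other inside that disc: on circles around its points which
  avoid it. So their values at a converge, to the missing value of the quotient
  at a, and they approximate the quotient everywhere. *)
Lemma entire_div f a : entire f -> f a = 0 ->
  exists2 g, entire g & forall z, f z = (z - a) * g z.
Proof.
move=> fE fa0; pose r0 := normc a + 3.
have eps n : 0 < n.+1%:R^-1 :> K by rewrite invr_gt0 ltr0n.
have /choice[p pf] : forall n : nat, exists p : {poly C},
  forall z, normc z <= r0 ->
  normc (f z - p.[z]) <= n.+1%:R^-1 by move=> n; exact: fE.
have quot (s : {poly C}) : exists q : {poly C},
    forall z, s.[z] - s.[a] = (z - a) * q.[z].
  have /factor_theorem[q sq] : root (s - s.[a]%:P) a.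
    by rewrite rootE !hornerE subrr.
  by exists q => z; have /(congr1 (horner^~ z)) := sq; rewrite !hornerE mulrC.
have /choice[q qE] := fun n => quot (p n).
(* an approximation s of f on z and a gives a quotient close to f z / (z - a) *)
have close (s t : {poly C}) (d : K) z :
    (forall z, s.[z] - s.[a] = (z - a) * t.[z]) ->
    normc (f z - s.[z]) <= d -> normc (f a - s.[a]) <= d ->
    z != a -> normc (f z / (z - a) - t.[z]) <= (2 * d) / normc (z - a).
  move=> sE zd ad za; have za0 : z - a != 0 by rewrite subr_eq0.
  rewrite ler_pdivlMr ?normc_gt0 // -normcM mulrBl mulfVK // [t.[z] * _]mulrC -sE.
  have -> : f z - (s.[z] - s.[a]) = (f z - s.[z]) - (f a - s.[a]).
    by rewrite fa0; ring.
  by apply: le_trans (le_normcB _ _) _; rewrite mulr_natl mulr2n lerD.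
have r0a : normc a <= r0 by rewrite lerDl.
have near_r0 z d : normc (z - a) <= 3 -> normc z <= r0.
  by move=> zd; apply: le_trans (le_normc_shift z a) _; rewrite lerD2l.
have [l ql] : exists l, forall m, normc (l - (q m).[a]) <= 4 / m.+1%:R.
  apply: complex_cauchy_limit => m n mn; rewrite -hornerN -hornerD.
  apply: (@poly_mean_value K _ _ 1) => // z z1; rewrite hornerD hornerN.
  have za : z != a by rewrite -subr_eq0 -normc_gt0 z1.
  have zr : normc z <= r0 by apply: near_r0 => //; rewrite z1; lra.
  apply: le_trans (le_normc_dist _ (f z / (z - a)) _) _.
  have Hn := close _ _ _ _ (qE n) (pf n _ zr) (pf n _ r0a) za.
  have Hm := close _ _ _ _ (qE m) (pf m _ zr) (pf m _ r0a) za.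
  have nm : n.+1%:R^-1 <= m.+1%:R^-1 :> K.
    by rewrite lef_pV2 ?posrE ?ltr0n // ler_nat ltnS.
  rewrite normc_distC; move: nm Hn Hm; rewrite z1 !divr1.
  by move: (n.+1%:R^-1 : K) (m.+1%:R^-1 : K) => x y; lra.
pose g z := if z == a then l else f z / (z - a).
exists g; last first.
  move=> z; rewrite /g; case: eqVneq => [->|za]; first by rewrite fa0 subrr mul0r.
  by rewrite mulrC mulfVK // subr_eq0.
have gq z : exists2 B, 0 < B & forall n, normc (z - a) <= 1 ->
    normc (g z - (q n).[z]) <= B / n.+1%:R.
  rewrite /g; case: eqVneq => [->|za]; first by exists 4.
  have za0 : 0 < normc (z - a) by rewrite normc_gt0 subr_eq0.
  exists (2 / normc (z - a)) => [|n z1]; first by rewrite divr_gt0.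
  have zr : normc z <= r0 by apply: near_r0 => //; lra.
  have := close _ _ _ _ (qE n) (pf n _ zr) (pf n _ r0a) za.
  by rewrite mulrAC.
move=> r e e0; have e30 : 0 < e / 4 by rewrite divr_gt0.
have [s sf] := fE (Num.max r r0) _ e30; have [t tE] := quot s.
have sa : normc (f a - s.[a]) <= e / 4 by apply: sf; rewrite le_max r0a orbT.
(* Outside the unit disc around a the estimate is direct. Inside, t is compared
   with q n on the circle of radius 2 around z, where |w - a| >= 1 and where
   r0 = |a| + 3 still bounds |w|; then n tends to infinity. *)
exists t => z zr; case: (leP 1 (normc (z - a))) => [z1|z1].
  have za : z != a by rewrite -subr_eq0 -normc_gt0 (lt_le_trans ltr01).
  have zs : normc (f z - s.[z]) <= e / 4 by apply: sf; rewrite le_max zr.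
  have := close _ _ _ _ tE zs sa za; rewrite /g (negPf za) => /le_trans; apply.
  rewrite ler_pdivrMr; last by rewrite normc_gt0 subr_eq0.
  have : e * 1 <= e * normc (z - a) by rewrite ler_pM2l.
  lra.
have [B B0 gB] := gq z.
pose n := Num.truncn ((B + 2) / (e / 2)).
have nP : (B + 2) / n.+1%:R <= e / 2.
  rewrite ler_pdivrMr ?ltr0n // mulrC -ler_pdivrMr ?divr_gt0 //.
  by apply/ltW; exact: truncnS_gt.
have tq : normc (t - q n).[z] <= e / 2 + 2 / n.+1%:R.
  apply: (@poly_mean_value K _ _ 2) => // w w2; rewrite hornerD hornerN.
  have wa1 : 1 <= normc (w - a).
    have := le_normc_dist w a z; rewrite w2 (normc_distC a z); lra.
  have wa : w != a by rewrite -subr_eq0 -normc_gt0 (lt_le_trans ltr01).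
  have wr : normc w <= r0.
    by apply: near_r0 => //; have := le_normc_dist w z a; rewrite w2; lra.
  have ws : normc (f w - s.[w]) <= e / 4 by apply: sf; rewrite le_max wr orbT.
  have Ht := close _ _ _ _ tE ws sa wa.
  have Hq := close _ _ _ _ (qE n) (pf n _ wr) (pf n _ r0a) wa.
  apply: le_trans (le_normc_dist _ (f w / (w - a)) _) _.
  rewrite normc_distC; apply: lerD.
    apply: le_trans Ht _; rewrite ler_pdivrMr; last by lra.
    have : e * 1 <= e * normc (w - a) by rewrite ler_pM2l.
    lra.
  apply: le_trans Hq _; rewrite ler_pdivrMr; last by lra.
  by rewrite ler_peMr // mulr_ge0 // ltW.
apply: le_trans (le_normc_dist _ (q n).[z] _) _.
have Hg := gB n (ltW z1).
have Ht : normc ((q n).[z] - t.[z]) <= e / 2 + 2 / n.+1%:R.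
  by rewrite normc_distC -hornerN -hornerD.
move: nP Hg Ht; rewrite mulrDl; move: (n.+1%:R^-1 : K) => x.
move: (B * x) (normc _) (normc _) => *; lra.
Qed.

End EntireFunctions.

(** * Zeros and growth *)

Section Zeros.
Variable K : realType.
Local Notation C := K[i].
Implicit Types (a z w : C) (f g : C -> C) (r e M : K).

(** The growth condition f z = O((z - a)^m) near a: all that is used of a zero
  of order m, and evidently stable under division by a function without zero at a. *)
Definition vanishing_order_ge f a (m : nat) := exists B d : K, [/\ 0 <= B, 0 < d &
  forall z, z != a -> normc (z - a) <= d -> normc (f z) <= B * normc (z - a) ^+ m].

Lemma near_complex a (P : C -> Prop) :
  (\forall z \near (a : C^o), P z) ->
  exists2 d : K, 0 < d & forall z, normc (z - a) <= d -> P z.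
Proof.
case/nbhs_ballP => -[e e'] /=; rewrite ltcE /= => /andP[/eqP -> e0] eP.
exists (e / 2) => [|z za]; first by rewrite divr_gt0.
apply: eP; rewrite /ball /= -normrN opprB normcE ltcR.
by apply: le_lt_trans za _; lra.
Qed.

Lemma vanishes_to_order_ge f a m :
  vanishes_to_order f a m -> vanishing_order_ge f a m.
Proof.
case=> g ghol fg.
have gcont : {for a, continuous g}.
  have /derivable1_diffP := nbhs_singleton ghol.
  exact: differentiable_continuous.
have /near_complex[d1 d10 g1] : \forall z \near (a : C^o), normc (g a - g z) <= 1.
  have /cvgrPdist_le/(_ 1 ltr01) := gcont.
  by apply: filterS => z; rewrite normcE -[1]/(1%:C) lecR.
have /near_complex[d2 d20 fE] := fg.
exists (normc (g a) + 1), (Num.min d1 d2); split.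
- by rewrite addr_ge0 ?normc_ge0.
- by rewrite lt_min d10.
move=> z _; rewrite le_min => /andP[/g1 gz /fE ->].
rewrite normcM normcX mulrC ler_wpM2r ?exprn_ge0 ?normc_ge0 //.
apply: le_trans (le_normc_shift (g z) (g a)) _; rewrite lerD2l.
by rewrite normc_distC.
Qed.

Lemma entire_div_order f a m : entire f -> vanishing_order_ge f a m ->
  exists2 g, entire g & forall z, f z = (z - a) ^+ m * g z.
Proof.
elim: m f => [|m IH] f fE [B [d [B0 d0 fB]]].
  by exists f => // z; rewrite expr0 mul1r.
have fa0 : f a = 0.
  apply/eqP; rewrite -normc_eq0 eq_le normc_ge0 andbT.
  apply/ler_addgt0Pr => e e0; rewrite add0r.
  have e20 : 0 < e / 2 by rewrite divr_gt0.
  have [d1 d10 fc] := entire_continuous a fE e20.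
  have eB : 0 < e / 2 / (B + 1) by rewrite divr_gt0 // ltr_wpDl.
  pose t := Num.min (Num.min d d1) (Num.min 1 (e / 2 / (B + 1))).
  have t0 : 0 < t by rewrite /t !lt_min d0 d10 ltr01 eB.
  have tn : normc (a + t%:C - a) = t.
    by rewrite addrAC subrr add0r normcR gtr0_norm.
  have zf : a + t%:C != a by rewrite -subr_eq0 -normc_gt0 tn.
  have [td td1 t1 teB] : [/\ t <= d, t <= d1, t <= 1 & t <= e / 2 / (B + 1)].
    by have := lexx t; rewrite {2}/t !le_min => /andP[/andP[-> ->] /andP[-> ->]].
  have H1 := fB _ zf; rewrite tn in H1; have {}H1 := H1 td.
  have H2 := fc (a + t%:C); rewrite tn in H2; have {}H2 := H2 td1.
  have H3 : B * t ^+ m.+1 <= e / 2.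
    rewrite ler_pdivlMr ?ltr_wpDl // in teB.
    apply: le_trans teB; rewrite mulrC ler_pM ?exprn_ge0 ?(ltW t0) ?lerDl //.
    by rewrite exprS ler_piMr ?(ltW t0) // exprn_ile1 // ltW.
  apply: le_trans (le_normc_shift (f a) (f (a + t%:C))) _.
  by rewrite normc_distC; lra.
have [g gE fg] := entire_div fE fa0.
have [|h hE gh] := IH g gE.
  exists B, d; split => // z za zd; have := fB z za zd.
  rewrite fg normcM exprS mulrCA ler_pM2l //.
  by rewrite normc_gt0 subr_eq0.
by exists h => // z; rewrite fg gh exprS mulrA.
Qed.

Lemma vanishing_order_quotient f g a b k m : b != a ->
  (forall z, f z = (z - a) ^+ k * g z) ->
  vanishing_order_ge f b m -> vanishing_order_ge g b m.
Proof.
move=> ba fg [B [d [B0 d0 fB]]].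
pose t := normc (b - a) / 2.
have t0 : 0 < t by rewrite divr_gt0 // normc_gt0 subr_eq0.
exists (B / t ^+ k), (Num.min d t); split.
- by rewrite divr_ge0 // exprn_ge0 // ltW.
- by rewrite lt_min d0.
move=> z zb; rewrite le_min => /andP[zd zt].
have za : t <= normc (z - a).
  have := le_normc_dist b z a; rewrite (normc_distC b z) /t in zt *; lra.
rewrite mulrAC ler_pdivlMr ?exprn_gt0 //.
apply: le_trans (fB z zb zd); rewrite fg normcM normcX mulrC.
by rewrite ler_wpM2r ?normc_ge0 // lerXn2r ?nnegrE ?normc_ge0 // ltW.
Qed.

Lemma entire_factor_zeros f (s : seq C) (m : C -> nat) : entire f -> uniq s ->
  (forall a, a \in s -> vanishing_order_ge f a (m a)) ->
  exists2 h, entire h &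
    forall z, f z = \prod_(a <- s) (z - a) ^+ m a * h z.
Proof.
elim: s f => [|a s IH] f fE /=.
  by move=> _ _; exists f => // z; rewrite big_nil mul1r.
move=> /andP[as' us] fm.
have [g gE fg] := entire_div_order fE (fm a (mem_head _ _)).
have [b bs|h hE gh] := IH g gE us.
  have ba : b != a by apply: contraNneq as' => <-.
  apply: (vanishing_order_quotient ba fg); apply: fm.
  by rewrite inE bs orbT.
by exists h => // z; rewrite fg gh big_cons mulrA.
Qed.

(** With f = W h, each linear factor of W has modulus at least 3 D on the circle
  and at most D at z0; the mean value property of h gives the ratio 3 ^ n. *)
Lemma zeros_le_growth f (s : seq C) (m : C -> nat) r D M z0 :
  entire f -> uniq s ->
  (forall a, a \in s -> normc a <= r /\ vanishing_order_ge f a (m a)) ->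
  0 < D -> normc z0 + r <= D ->
  (forall z, normc (z - z0) = 4 * D -> normc (f z) <= M) ->
  3 ^+ (\sum_(a <- s) m a)%N * normc (f z0) <= M.
Proof.
move=> fE us fm D0 zrD fM.
have [|h hE fh] := entire_factor_zeros (m := m) fE us; first by move=> a /fm[].
set n := (\sum_(a <- s) m a)%N.
have hM : normc (h z0) <= M / (3 * D) ^+ n.
  apply: (@entire_mean_value _ _ _ (4 * D)) => // [|z zD].
    by rewrite mulr_ge0 // ltW.
  rewrite ler_pdivlMr ?exprn_gt0 ?mulr_gt0 //; apply: le_trans (fM z zD).
  rewrite fh normcM normc_prod mulrC ler_wpM2r ?normc_ge0 // /n -prodrXr.
  rewrite !big_seq; apply: ler_prod => a /fm[ar _].
  rewrite exprn_ge0 ?mulr_ge0 ?(ltW D0) //= normcX.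
  rewrite lerXn2r ?nnegrE ?normc_ge0 ?mulr_ge0 ?(ltW D0) //.
  have := le_normc_dist z a z0; rewrite zD.
  have := le_normcB a z0; lra.
have fD : normc (f z0) <= D ^+ n * normc (h z0).
  rewrite fh normcM normc_prod ler_wpM2r ?normc_ge0 // /n -prodrXr.
  rewrite !big_seq; apply: ler_prod => a /fm[ar _].
  rewrite normc_ge0 /= normcX lerXn2r ?nnegrE ?normc_ge0 ?(ltW D0) //.
  apply: le_trans (le_normcB _ _) _; lra.
apply: le_trans (ler_wpM2l _ fD) _; first by rewrite exprn_ge0.
rewrite mulrA -exprMn mulrC -ler_pdivlMr //.
by rewrite exprn_gt0 // mulr_gt0.
Qed.

End Zeros.

(** * Interpolation *)

Lemma poly_eq0_injective (A : idomainType) (u : nat -> A) (p : {poly A}) :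
  injective u -> (forall n, p.[u n] = 0) -> p = 0.
Proof.
move=> uinj pu; apply: (@roots_geq_poly_eq0 _ _ (mkseq u (size p))).
- by apply/allP => x /mapP[n _ ->]; rewrite rootE pu.
- by rewrite map_inj_uniq // iota_uniq.
- by rewrite size_mkseq.
Qed.

Section Interpolation.
Variable K : realType.
Local Notation C := K[i].
Implicit Types (p : {poly C}) (P : {poly {poly C}}) (z w v : C) (x : nat -> C).

Lemma separated_injective x (d : K) : 0 < d ->
  (forall i j, i != j -> d <= normc (x i - x j)) -> injective x.
Proof.
move=> d0 xd i j xij; apply/eqP/negPn/negP => /xd.
by rewrite xij subrr normc0 leNgt d0.
Qed.

Lemma interpolation_bound p n x z (d T M : K) :
  (size p <= n.+1)%N -> 0 < d ->
  (forall i j, i != j -> d <= normc (x i - x j)) ->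
  (forall i, (i <= n)%N -> normc (z - x i) <= T) ->
  (forall i, (i <= n)%N -> normc p.[x i] <= M) ->
  normc p.[z] <= n.+1%:R * (T / d) ^+ n * M.
Proof.
move=> sp d0 xd zT pM.
have xinj := separated_injective d0 xd.
rewrite [p](lagrange_gen _ xinj sp) // horner_sum.
apply: le_trans (normc_sum _ _ _) _.
rewrite -mulrA mulr_natl -[in leRHS](card_ord n.+1) -sumr_const.
apply: ler_sum => i _; rewrite hornerM hornerC normcM mulrC.
apply: ler_pM; rewrite ?normc_ge0 //; last first.
  by apply: pM; rewrite -ltnS.
rewrite lagrangeE // /= hornerM hornerC !horner_prod -prodfV -big_split /=.
have cardi : #|predC1 i| = n by rewrite cardC1 card_ord.
rewrite normc_prod -[in leRHS]cardi -prodr_const; apply: ler_prod => j ji.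
rewrite normc_ge0 /= !hornerE mulrC normcM normcV.
have T0 : 0 <= T by apply: le_trans (zT 0%N _); rewrite ?normc_ge0.
apply: ler_pM; rewrite ?invr_ge0 ?normc_ge0 //.
  by apply: zT; rewrite -ltnS.
rewrite lef_pV2 ?posrE //; last first.
  by rewrite normc_gt0 subr_eq0; apply: contra_neq ji => /xinj/val_inj ->.
by apply: xd; rewrite eq_sym.
Qed.

Lemma eval2_map P z w : eval2 P z w = (map_poly (horner_eval z) P).[w].
Proof.
rewrite -[LHS]/(horner_eval z P.[w%:P]) -horner_map /=.
by rewrite [horner_eval z w%:P]hornerC.
Qed.

Lemma size_eval_snd L P w : bidegree_le L P -> (size P.[w%:P] <= L.+1)%N.
Proof.
move=> [_ PL]; rewrite horner_coef; apply: (leq_trans (size_sum _ _ _)).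
apply/bigmax_leqP => j _; rewrite -rmorphXn /=.
by rewrite mulrC mul_polyC (leq_trans (size_scale_leq _ _)).
Qed.

(** Interpolation in w at the nodes w j, and in z at nodes x j _ which may depend
  on j. *)
Lemma eval2_bound L P (x : nat -> nat -> C) (w : nat -> C) z v (d T W M : K) :
  bidegree_le L P -> 0 < d ->
  (forall j i k, i != k -> 1 <= normc (x j i - x j k)) ->
  (forall i j, i != j -> d <= normc (w i - w j)) ->
  (forall j i, (j <= L)%N -> (i <= L)%N -> normc (z - x j i) <= T) ->
  (forall j, (j <= L)%N -> normc (v - w j) <= W) ->
  (forall j i, (j <= L)%N -> (i <= L)%N -> normc (eval2 P (x j i) (w j)) <= M) ->
  normc (eval2 P z v) <= L.+1%:R * (W / d) ^+ L * (L.+1%:R * T ^+ L * M).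
Proof.
move=> PL d0 x1 wd zT vW PM; rewrite eval2_map.
apply: interpolation_bound d0 wd vW _.
  by case: PL => PL _; rewrite (leq_trans (size_poly _ _)).
move=> j jL; rewrite -eval2_map /eval2 -[T]divr1.
apply: interpolation_bound ltr01 (x1 j) _ _; first exact: size_eval_snd.
  by move=> i iL; exact: zT.
by move=> i iL; exact: PM.
Qed.

Lemma eval2_eq0 P : (forall z w, eval2 P z w = 0) -> P = 0.
Proof.
have natI : injective (fun n : nat => n%:R : C).
  by move=> m n /eqP; rewrite eqr_nat => /eqP.
move=> P0; apply: (@poly_eq0_injective _ (fun n : nat => (n%:R : C)%:P)).
  by move=> m n /polyC_inj/natI.
by move=> n; apply: poly_eq0_injective natI _ => k; exact: P0.
Qed.

Lemma entire_eval2 P (g : C -> C) : entire g -> entire (fun z => eval2 P z (g z)).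
Proof.
move=> gE; elim/poly_ind: P => [|P c IH].
  apply: entire_ext (entire_poly 0) => z.
  by rewrite /eval2 !horner0.
apply: entire_ext (entireD (entireM IH gE) (entire_poly c)) => z.
by rewrite /eval2 !hornerE.
Qed.

End Interpolation.

(** * The complex exponential *)

Section TrigBounds.
Variable K : realType.
Implicit Types x y : K.

Lemma mean_value_ineq0 (f df : K -> K) x (M : K) : (forall t : K, is_derive t 1 f (df t)) ->
  f 0 = 0 -> (forall t, `|t| <= `|x| -> `|df t| <= M) -> `|f x| <= M * `|x|.
Proof.
move=> fdf f0 dfM.
have fc (a b : K) : {within `[a, b], continuous f}.
  apply: continuous_subspaceT => t; apply: differentiable_continuous.
  by apply/derivable1_diffP; have [] := fdf t.
have [x0|x0|->] := ltgtP x 0; last by rewrite f0 !normr0 mulr0.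
- have [c] := MVT x0 (fun t _ => fdf t) (fc x 0).
  rewrite in_itv /= f0 sub0r => /andP[xc c0] /eqP.
  rewrite eqr_oppLR sub0r mulrN opprK => /eqP ->.
  by rewrite normrM ler_wpM2r // dfM // !ltr0_norm // lerN2 ltW.
- have [c] := MVT x0 (fun t _ => fdf t) (fc 0 x).
  rewrite in_itv /= f0 !subr0 => /andP[c0 cx] ->.
  by rewrite normrM ler_wpM2r // dfM // !gtr0_norm // ltW.
Qed.

Lemma abs_sin_le x : `|sin x| <= `|x|.
Proof.
rewrite -[leRHS]mul1r; apply: (mean_value_ineq0 (df := cos)) => [|t _].
  exact: sin0.
exact: cos_max.
Qed.

Lemma abs_cos_sub1 x : `|cos x - 1| <= x ^+ 2 / 2.
Proof.
have -> : cos x - 1 = - (2 * sin (x / 2) ^+ 2).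
  have -> : cos x = cos ((x / 2) *+ 2) by congr cos; rewrite mulr2n; lra.
  rewrite cos_mulr2n cos2sin2 mulr2n; ring.
rewrite normrN normrM normrX ger0_norm //.
have -> : x ^+ 2 / 2 = 2 * `|x / 2| ^+ 2 by rewrite real_normK ?num_real //; field.
by rewrite ler_wpM2l // lerXn2r ?nnegrE // abs_sin_le.
Qed.

Lemma abs_sin_sub x : `|sin x - x| <= `|x| ^+ 3 / 2.
Proof.
have -> : `|x| ^+ 3 / 2 = x ^+ 2 / 2 * `|x|.
  by rewrite exprS mulrC real_normK ?num_real //; ring.
apply: (@mean_value_ineq0 (fun t => sin t - t) (fun t => cos t - 1)).
- by rewrite sin0 subr0.
- move=> t tx; apply: le_trans (abs_cos_sub1 t) _.
  rewrite ler_pM2r ?invr_gt0 // -[leLHS]real_normK ?num_real //.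
  by rewrite -[leRHS]real_normK ?num_real // lerXn2r ?nnegrE.
Qed.

Lemma expR_mulB_le1 x : expR x * (1 - x) <= 1.
Proof.
have := expR_ge1Dx (- x); rewrite expRN => H; have e0 := expR_gt0 x.
by rewrite -[leRHS](divff (lt0r_neq0 e0)) ler_pM2l.
Qed.

Lemma expR_le2 x : x <= 1 / 2 -> expR x <= 2.
Proof. by move=> x2; have := expR_mulB_le1 x; have := expR_gt0 x; nra. Qed.

Lemma abs_expR_sub x : `|x| <= 1 / 2 -> `|expR x - 1 - x| <= 2 * x ^+ 2.
Proof.
move=> x2; have [xl xu] : - (1 / 2) <= x /\ x <= 1 / 2.
  by apply/andP; rewrite -ler_norml.
have H1 := expR_ge1Dx x; have H3 := expR_mulB_le1 x; have e0 := expR_gt0 x.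
rewrite ger0_norm; last lra.
nra.
Qed.

End TrigBounds.

Section ComplexExponential.
Variable K : realType.
Local Notation C := K[i].
Implicit Types (z w : C) (x : K).

Lemma cexpD z w : cexp (z + w) = cexp z * cexp w.
Proof.
case: z w => [a b] [c d]; rewrite /cexp /= expRD cosD sinD; simpc.
congr (_ +i* _); ring.
Qed.

Lemma cexpR x : cexp x%:C = (expR x)%:C.
Proof. by rewrite /cexp /= cos0 sin0 mulr1 mulr0. Qed.

Lemma cexp0 : cexp (0 : C) = 1.
Proof. by rewrite -[0]/(0%:C) cexpR expR0. Qed.

Lemma cexpN z : cexp (- z) = (cexp z)^-1.
Proof.
have H : cexp (- z) * cexp z = 1 by rewrite -cexpD addNr cexp0.
have z0 : cexp z != 0.
  by apply: contra_eq_neq H => ->; rewrite mulr0 eq_sym oner_eq0.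
by rewrite -[LHS](mulfK z0) H mul1r.
Qed.

Lemma cexp_neq0 z : cexp z != 0.
Proof.
apply/eqP => z0; have := cexpD z (- z); rewrite subrr cexp0 z0 mul0r.
by move/eqP; rewrite oner_eq0.
Qed.

Lemma cexpMn z n : cexp (n%:R * z) = cexp z ^+ n.
Proof.
elim: n => [|n IH]; first by rewrite mul0r cexp0 expr0.
by rewrite -natr1 mulrDl mul1r cexpD IH exprSr.
Qed.

Lemma normc_cexp z : normc (cexp z) = expR (complex.Re z).
Proof.
case: z => a b; rewrite /cexp /normc /= !exprMn -mulrDr cos2Dsin2 mulr1.
by rewrite sqrtr_sqr ger0_norm // expR_ge0.
Qed.

Lemma cexp_near0 z : normc z <= 1 / 2 ->
  normc (cexp z - 1 - z) <= 8 * normc z ^+ 2.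
Proof.
move=> z2; have := Re_le_normc z; have := Im_le_normc z.
case: z z2 => a b; set r := normc _; rewrite /cexp /= => r2 br ar.
apply: le_trans (normc_le_ReIm _) _ => /=.
have a2 : `|a| <= 1 / 2 by lra.
have b2 : `|b| <= 1 / 2 by lra.
have ea := abs_expR_sub a2; have sb := abs_sin_sub b; have cb := abs_cos_sub1 b.
have sqa : a ^+ 2 = `|a| ^+ 2 by rewrite real_normK ?num_real.
have sqb : b ^+ 2 = `|b| ^+ 2 by rewrite real_normK ?num_real.
rewrite sqa in ea; rewrite sqb in cb.
have a0 := normr_ge0 a; have b0 := normr_ge0 b.
have sqra : `|a| ^+ 2 <= r ^+ 2 by rewrite lerXn2r ?nnegrE ?normc_ge0.
have sqrb : `|b| ^+ 2 <= r ^+ 2 by rewrite lerXn2r ?nnegrE ?normc_ge0.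
have sqrab : `|a| * `|b| <= r ^+ 2 by rewrite expr2 ler_pM.
have e2 : expR a <= 2 by apply: expR_le2; apply: le_trans (ler_norm a) _.
have e1 : `|expR a - 1| <= 2 * `|a|.
  have -> : expR a - 1 = (expR a - 1 - a) + a by ring.
  by apply: le_trans (ler_normD _ _) _; nra.
have HRe : `|expR a * cos b - 1 - a| <= 3 * r ^+ 2.
  have -> : expR a * cos b - 1 - a = (expR a - 1 - a) + expR a * (cos b - 1) by ring.
  apply: le_trans (ler_normD _ _) _; rewrite normrM (ger0_norm (expR_ge0 a)).
  have : expR a * `|cos b - 1| <= 2 * (`|b| ^+ 2 / 2) by rewrite ler_pM ?expR_ge0.
  lra.
have HIm : `|expR a * sin b - b| <= 3 * r ^+ 2.
  have -> : expR a * sin b - b = expR a * (sin b - b) + (expR a - 1) * b by ring.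
  apply: le_trans (ler_normD _ _) _; rewrite !normrM (ger0_norm (expR_ge0 a)).
  have : expR a * `|sin b - b| <= 2 * (`|b| ^+ 3 / 2) by rewrite ler_pM ?expR_ge0.
  have : `|b| ^+ 3 <= `|b| ^+ 2 by rewrite [leLHS]exprS ler_piMl ?exprn_ge0 //; lra.
  have : `|expR a - 1| * `|b| <= 2 * `|a| * `|b| by rewrite ler_wpM2r.
  lra.
simpc; have := sqr_ge0 r; lra.
Qed.

Lemma normc_subX_le z w (q : K) n : normc z <= q -> normc w <= q ->
  normc (z ^+ n.+1 - w ^+ n.+1) <= n.+1%:R * q ^+ n * normc (z - w).
Proof.
move=> zq wq; rewrite subrXX normcM mulrC ler_wpM2r ?normc_ge0 //.
apply: le_trans (normc_sum _ _ _) _.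
rewrite mulr_natl -[in leRHS](card_ord n.+1) -sumr_const.
apply: ler_sum => i _; rewrite normcM !normcX /=.
have -> : q ^+ n = q ^+ (n.+1.-1 - i) * q ^+ i.
  by rewrite -exprD subnK // -ltnS.
have q0 : 0 <= q by apply: le_trans zq; exact: normc_ge0.
by rewrite ler_pM ?exprn_ge0 ?normc_ge0 // lerXn2r ?nnegrE ?normc_ge0.
Qed.

(** The approximants are (1 + z c / m) ^ m: since cexp (z c) = cexp (z c / m) ^ m,
  a quadratic error in one factor becomes O(1/m) in the product. *)
Lemma entire_cexp (c : C) : entire (fun z => cexp (z * c)).
Proof.
move=> r e e0; pose s := `|r| * normc c.
have s0 : 0 <= s by rewrite mulr_ge0 ?normc_ge0.
pose m := (Num.truncn (2 * s + expR s * (8 * s ^+ 2) / e)).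
have mP : 2 * s + expR s * (8 * s ^+ 2) / e <= m.+1%:R by apply/ltW/truncnS_gt.
have m0 : 0 < m.+1%:R :> K by rewrite ltr0n.
have t0 : 0 <= expR s * (8 * s ^+ 2) / e.
  by rewrite divr_ge0 ?(ltW e0) // mulr_ge0 ?expR_ge0 // mulr_ge0 // sqr_ge0.
exists ((1 + (c / m.+1%:R)%:P * 'X) ^+ m.+1) => z zr.
rewrite !hornerE.
pose w := z * c / m.+1%:R.
have -> : z * c = m.+1%:R * w by rewrite /w [RHS]mulrC divfK // pnatr_eq0.
have -> : c / m.+1%:R * z = w by rewrite /w mulrAC [c * z]mulrC.
have ws : normc w <= s / m.+1%:R.
  rewrite /w !normcM normcV normc_nat ler_pM2r ?invr_gt0 //.
  rewrite ler_wpM2r ?normc_ge0 //; apply: le_trans zr _; exact: ler_norm.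
have w2 : normc w <= 1 / 2.
  by apply: le_trans ws _; rewrite ler_pdivrMr //; lra.
rewrite cexpMn; pose q := expR (s / m.+1%:R).
have H1 : normc (cexp w) <= q.
  rewrite normc_cexp ler_expR; apply: le_trans (ler_norm _) _.
  by apply: le_trans (Re_le_normc w) _.
have H2 : normc (1 + w) <= q.
  apply: le_trans (le_normcD _ _) _; rewrite normc1.
  by apply: le_trans (expR_ge1Dx _); rewrite lerD2l.
apply: le_trans (normc_subX_le _ H1 H2) _.
have H3 : q ^+ m <= expR s.
  rewrite /q -expRM_natl ler_expR mulrCA ler_piMr //.
  by rewrite ler_pdivrMr // mul1r ler_nat.
have H4 : normc (cexp w - (1 + w)) <= 8 * (s / m.+1%:R) ^+ 2.
  rewrite opprD addrA; apply: le_trans (cexp_near0 w2) _.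
  by rewrite ler_wpM2l // lerXn2r ?nnegrE ?normc_ge0 // divr_ge0 // ltW.
have H5 : q ^+ m * normc (cexp w - (1 + w)) <= expR s * (8 * (s / m.+1%:R) ^+ 2).
  by rewrite ler_pM ?normc_ge0 ?exprn_ge0 ?expR_ge0.
rewrite -mulrA; apply: le_trans (ler_wpM2l (ltW m0) H5) _.
have -> : m.+1%:R * (expR s * (8 * (s / m.+1%:R) ^+ 2)) =
   expR s * (8 * s ^+ 2) / m.+1%:R by field; rewrite gt_eqF.
rewrite ler_pdivrMr // [e * _]mulrC -ler_pdivrMr //.
by apply: le_trans mP; rewrite lerDr mulr_ge0.
Qed.

End ComplexExponential.

(** * The reciprocal of the Gamma function *)

Section ConvergenceByModulus.
Variable K : realType.
Local Notation C := K[i].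

Lemma complex_cvgP (u : nat -> C^o) (l : C^o) :
  (u n @[n --> \oo] --> l) <->
  (forall e : K, 0 < e -> exists N, forall n, (N <= n)%N -> normc (l - u n) <= e).
Proof.
split=> [ul e e0|ul].
  have e0' : (0 : C) < e%:C by rewrite ltcR.
  have /cvgrPdist_le/(_ _ e0')[N _ HN] := ul.
  by exists N => n /HN /=; rewrite normcE lecR.
apply/cvgrPdist_le => -[e e']; rewrite ltcE /= => /andP[/eqP -> e0].
have [N HN] := ul e e0; exists N => // n /HN; by rewrite normcE lecR.
Qed.

Lemma complex_cvgM (u v : nat -> C^o) (l m : C^o) :
  u n @[n --> \oo] --> l -> v n @[n --> \oo] --> m ->
  (u n * v n : C^o) @[n --> \oo] --> (l * m : C^o).
Proof. by move=> ul vm; exact: (@cvgM C nat \oo _ u v l m ul vm). Qed.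

Lemma complex_cvg_bounded (u : nat -> C^o) (l : C^o) w (B : K) N :
  u n @[n --> \oo] --> l ->
  (forall n, (N <= n)%N -> normc (u n - w) <= B) -> normc (l - w) <= B.
Proof.
move=> /complex_cvgP ul uB; apply/ler_addgt0Pr => e e0.
have [N' HN] := ul e e0.
apply: le_trans (le_normc_dist _ (u (maxn N N')) _) _; rewrite addrC.
by apply: lerD; [apply: uB; exact: leq_maxl | apply: HN; exact: leq_maxr].
Qed.

(** The bounds on the factors telescope: the factors from N on have a product of
  modulus at most exp (A/N), and from m on they move it by at most A/m times
  that. *)
Lemma near1_product_bound (a phi : nat -> C) (A : K) N : (0 < N)%N -> 0 <= A ->
  (forall n, (N <= n)%N -> a n.+1 = a n * phi n) ->
  (forall n, (N <= n)%N -> normc (phi n - 1) <= A * (n%:R^-1 - n.+1%:R^-1)) ->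
  forall m n, (N <= m <= n)%N ->
    normc (a n - a m) <= normc (a N) * expR (A / N%:R) * (A / m%:R).
Proof.
move=> N0 A0 aS phi1.
have aN k : normc (a (N + k)%N) <=
    normc (a N) * expR (A * (N%:R^-1 - (N + k)%:R^-1)).
  elim: k => [|k IH]; first by rewrite addn0 subrr mulr0 expR0 mulr1.
  rewrite addnS aS ?leq_addr // normcM.
  have Hphi := phi1 (N + k)%N (leq_addr _ _).
  have : normc (phi (N + k)%N) <=
      expR (A * ((N + k)%:R^-1 - (N + k).+1%:R^-1)).
    apply: le_trans (expR_ge1Dx _).
    by apply: le_trans (le_normc_shift _ 1) _; rewrite normc1 lerD2l.
  move=> /(ler_pM (normc_ge0 _) (normc_ge0 _) IH) /le_trans; apply.
  rewrite -mulrA -expRD -mulrDr.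
  by rewrite [_ - _ + _]addrA subrK.
have aNn n : (N <= n)%N -> normc (a n) <= normc (a N) * expR (A / N%:R).
  move=> Nn; have := aN (n - N)%N; rewrite subnKC // => /le_trans; apply.
  rewrite ler_wpM2l ?normc_ge0 // ler_expR ler_wpM2l //.
  by rewrite gerBl invr_ge0.
set B := normc (a N) * _ in aNn *.
have B0 : 0 <= B by rewrite mulr_ge0 ?normc_ge0 ?expR_ge0.
move=> m n /andP[Nm mn].
suff H k : normc (a (m + k)%N - a m) <= B * (A * (m%:R^-1 - (m + k)%:R^-1)).
  have := H (n - m)%N; rewrite subnKC // => /le_trans; apply.
  by rewrite ler_wpM2l // ler_wpM2l // gerBl invr_ge0.
elim: k => [|k IH]; first by rewrite addn0 !subrr normc0 !mulr0.
apply: le_trans (le_normc_dist _ (a (m + k)%N) _) _.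
have Nmk : (N <= m + k)%N by apply: leq_trans Nm _; exact: leq_addr.
have : normc (a (m + k).+1 - a (m + k)%N) <=
    B * (A * ((m + k)%:R^-1 - (m + k).+1%:R^-1)).
  rewrite aS // -[X in _ - X]mulr1 -mulrBr normcM.
  by rewrite ler_pM ?normc_ge0 // ?aNn // phi1.
rewrite addnS => /lerD /(_ IH) /le_trans; apply.
rewrite -mulrDr -mulrDr addrC [_ - _ + _]addrA subrK.
by [].
Qed.

End ConvergenceByModulus.

Section ReciprocalGamma.
Variable K : realType.
Local Notation C := K[i].
Implicit Types (z w : C) (r x : K).

(** The reciprocals of the Euler products; unlike these they are entire in z. *)
Definition rgamma_seq z (n : nat) : C^o :=
  \prod_(k < n.+1) (z + k%:R) * cexp (- (z * (ln (n%:R : K))%:C)) / n`!%:R.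

Lemma Gamma_seqE z n : Gamma_seq z n = (rgamma_seq z n)^-1.
Proof.
rewrite /Gamma_seq /rgamma_seq cexpN !invfM !invrK.
by rewrite [RHS]mulrC [_^-1 * _]mulrC mulrA.
Qed.

(** The step from n to n + 1 of the exponent in n ^ (- z); it is close to 1/n, which
  is why z / (n + 1) - z [log_step n], the first order part of the n-th factor
  minus 1, is O(1/n^2). *)
Definition log_step n : K := ln n.+1%:R - ln n%:R.

Definition rgamma_factor z n : C :=
  (1 + z / n.+1%:R) * cexp (- (z * (log_step n)%:C)).

Lemma rgamma_seqS z n : rgamma_seq z n.+1 = rgamma_seq z n * rgamma_factor z n.
Proof.
rewrite /rgamma_seq /rgamma_factor big_ord_recr /=.
have -> : - (z * (ln (n.+1%:R : K))%:C) =
    - (z * (ln (n%:R : K))%:C) + - (z * (log_step n)%:C).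
  by rewrite /log_step rmorphB /=; ring.
rewrite cexpD factS natrM.
have f0 : n`!%:R != 0 :> C by rewrite pnatr_eq0 -lt0n fact_gt0.
have n0 : n.+1%:R != 0 :> C by rewrite pnatr_eq0.
move: (n.+1%:R : C) (n`!%:R : C) n0 f0 => a b a0 b0.
move: (cexp _) (cexp _) (\prod_(_ < _) _) => c d e.
by field; rewrite a0 b0.
Qed.

Lemma log_step_bounds n : (0 < n)%N -> n.+1%:R^-1 <= log_step n <= n%:R^-1.
Proof.
move=> n0; have n0' : 0 < n%:R :> K by rewrite ltr0n.
have n1' : 0 < n.+1%:R :> K by rewrite ltr0n.
rewrite /log_step -ln_div ?posrE //; apply/andP; split.
  rewrite -lerN2 -lnV ?posrE ?divr_gt0 //.
  have -> : (n.+1%:R / n%:R)^-1 = 1 + (- n.+1%:R^-1) :> K.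
    by rewrite invf_div -natr1; field; rewrite natr1 gt_eqF.
  by apply: le_ln1Dx; rewrite ltrN2 invf_lt1 // ltr1n ltnS.
have -> : n.+1%:R / n%:R = 1 + n%:R^-1 :> K.
  by rewrite -natr1; field; rewrite gt_eqF.
by apply: le_ln1Dx; apply: lt_trans (ltrN10 _) _; rewrite invr_gt0.
Qed.

(** To first order (1 + z/(n+1)) exp (- z t) - 1 is z (1/(n+1) - t), of order
  r / n^2, and the other terms are of order r^2 / n^2. The constant 28 leaves room
  over 1 + 1 + 2 * 12: the error of the exponential contributes at most
  (3/2) 8 r^2 / n^2, and 1/n^2 <= 2 (1/n - 1/(n+1)). *)
Lemma rgamma_factor_near1 z r n : 1 <= r -> normc z <= r -> 2 * r <= n%:R ->
  normc (rgamma_factor z n - 1) <= 28 * r ^+ 2 * (n%:R^-1 - n.+1%:R^-1).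
Proof.
move=> r1 zr rn.
have n2 : 2 <= n%:R :> K by lra.
have n0 : (0 < n)%N by rewrite -(ltr0n K); lra.
have := log_step_bounds n0; rewrite /rgamma_factor.
move: (log_step n) => t /andP[tl tu].
have n1E : n.+1%:R = n%:R + 1 :> K by rewrite natr1.
have zn : normc (z / n.+1%:R) <= 1 / 2.
  rewrite normcM normcV normc_nat ler_pdivrMr ?ltr0n // n1E; lra.
have n1E' : normc (n.+1%:R^-1 : C) = n.+1%:R^-1 by rewrite normcV normc_nat.
have cnE : n.+1%:R^-1 = (n.+1%:R^-1 : K)%:C by rewrite fmorphV rmorph_nat.
move: n1E'; rewrite cnE in zn *; rewrite n1E in tl cnE zn *.
move: (n%:R : K) n2 rn tl tu zn => {cnE n1E n0}n n2 rn tl tu zn n1E.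
have n0 : 0 < n by lra.
have n10 : 0 < n + 1 by lra.
set s := (n + 1)^-1 in tl zn n1E *; set u := n^-1 in tu *.
have u0 : 0 < u by rewrite invr_gt0.
have s0 : 0 < s by rewrite invr_gt0.
have un : u * n = 1 by rewrite mulVf ?gt_eqF.
have sn : s * (n + 1) = 1 by rewrite mulVf ?gt_eqF.
have t0 : 0 < t by lra.
have us : u - s = u * s.
  by rewrite /u /s; field; rewrite !gt_eqF.
have su : s <= u by have := mulr_ge0 (ltW u0) (ltW s0); lra.
have usu : u <= 2 * s.
  have -> : u = (u * s) * (n + 1) by rewrite -mulrA sn mulr1.
  have -> : 2 * s = u * s * (2 * n) by rewrite mulrCA mulrAC un mul1r; ring.
  by rewrite ler_pM2l ?mulr_gt0 //; lra.
have zt : normc (z * t%:C) <= r * u.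
  by rewrite normcM normcR gtr0_norm // ler_pM ?normc_ge0 // ltW.
have ru : r * u <= 1 / 2.
  have : 2 * r * u <= n * u by rewrite ler_pM2r.
  rewrite [n * u]mulrC un; lra.
have vz : normc (- (z * t%:C)) <= 1 / 2 by rewrite normcN (le_trans zt).
have Ez := cexp_near0 vz; rewrite normcN in Ez.
set E := cexp _ - 1 - _ in Ez.
have -> : (1 + z * s%:C) * cexp (- (z * t%:C)) - 1 =
   z * (s - t)%:C - z * s%:C * (z * t%:C) + (1 + z * s%:C) * E.
  by rewrite /E rmorphB /=; ring.
have z0 := normc_ge0 z.
have B1 : normc (z * (s - t)%:C) <= r * (u * s).
  rewrite normcM normcR ler_pM // -normrN opprB ger0_norm ?subr_ge0 //.
  by rewrite -us lerD2r.
have B2 : normc (z * s%:C * (z * t%:C)) <= (r * s) * (r * u).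
  rewrite normcM ler_pM ?normc_ge0 // normcM normcR gtr0_norm //.
  by rewrite ler_pM // ltW.
have B3 : normc ((1 + z * s%:C) * E) <= (3 / 2) * (8 * (r * u) ^+ 2).
  rewrite normcM ler_pM ?normc_ge0 //.
    apply: le_trans (le_normcD _ _) _; rewrite normc1; lra.
  apply: le_trans Ez _; rewrite ler_wpM2l // lerXn2r ?nnegrE ?normc_ge0 //.
  by rewrite mulr_ge0 ?(ltW u0) //; lra.
apply: le_trans (le_normcD _ _) _.
apply: le_trans (lerD (le_normcB _ _) (lexx _)) _.
apply: le_trans (lerD (lerD B1 B2) B3) _; rewrite us.
have us0 : 0 < u * s by rewrite mulr_gt0.
have C1 : r * (u * s) <= r ^+ 2 * (u * s).
  by rewrite ler_pM2r // expr2 ler_peMl //; lra.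
have C2 : r ^+ 2 * u ^+ 2 <= 2 * (r ^+ 2 * (u * s)).
  rewrite [leRHS]mulrCA ler_wpM2l ?sqr_ge0 //.
  by rewrite [2 * _]mulrCA expr2 ler_pM2l.
have C3 : 0 <= r ^+ 2 * (u * s) by rewrite mulr_ge0 ?sqr_ge0 // ltW.
have -> : r * s * (r * u) = r ^+ 2 * (u * s) by ring.
rewrite exprMn -[28 * _ * _]mulrA.
move: C1 C2 C3; set X := r ^+ 2 * (u * s); set Y := r ^+ 2 * u ^+ 2.
lra.
Qed.

Lemma rgamma_seq_tail z r N m n : 1 <= r -> normc z <= r -> 2 * r <= N%:R ->
  (N <= m <= n)%N ->
  normc (rgamma_seq z n - rgamma_seq z m) <=
    normc (rgamma_seq z N) * expR (28 * r ^+ 2 / N%:R) * (28 * r ^+ 2 / m%:R).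
Proof.
move=> r1 zr rN; apply: near1_product_bound => [||k _|k Nk].
- by rewrite -(ltr0n K); lra.
- by rewrite mulr_ge0 // sqr_ge0.
- exact: rgamma_seqS.
- by apply: rgamma_factor_near1 => //; apply: le_trans rN _; rewrite ler_nat.
Qed.

Lemma rgamma_seq_neq0 z n : (forall k : nat, z <> - k%:R) -> rgamma_seq z n != 0.
Proof.
move=> zk; apply: mulf_neq0; last first.
  by rewrite invr_neq0 // pnatr_eq0 -lt0n fact_gt0.
apply: mulf_neq0; last exact: cexp_neq0.
by apply/prodf_neq0 => k _; rewrite addr_eq0; apply/eqP; exact: zk.
Qed.

(** Far enough in the sequence the remaining factors are so close to 1 that they
  cannot halve the modulus. *)
Lemma rgamma_seq_lower z : (forall k : nat, z <> - k%:R) ->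
  exists2 b, 0 < b & exists M, forall n, (M <= n)%N -> b <= normc (rgamma_seq z n).
Proof.
move=> zk; pose r := 1 + normc z.
have r1 : 1 <= r by rewrite lerDl normc_ge0.
have zr : normc z <= r by rewrite lerDr.
have r2 : 0 <= r ^+ 2 by rewrite sqr_ge0.
pose M := (Num.truncn (2 * r + 112 * r ^+ 2)).+1.
have MP : 2 * r + 112 * r ^+ 2 <= M%:R by apply/ltW/truncnS_gt.
have M0 : 0 < M%:R :> K by rewrite ltr0n.
have cM0 := normc_gt0 (rgamma_seq z M); rewrite rgamma_seq_neq0 // in cM0.
exists (normc (rgamma_seq z M) / 2); first by rewrite divr_gt0.
exists M => n Mn.
have rM : 2 * r <= M%:R by lra.
have := rgamma_seq_tail r1 zr rM (m := M) (n := n); rewrite leqnn => /(_ Mn).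
set t := 28 * r ^+ 2 / M%:R.
have t4 : t <= 1 / 4 by rewrite /t ler_pdivrMr //; lra.
have t0 : 0 <= t by rewrite divr_ge0 ?(ltW M0) // mulr_ge0.
have et : expR t <= 2 by apply: expR_le2; lra.
have H1 : normc (rgamma_seq z M) * expR t * t <= normc (rgamma_seq z M) / 2.
  rewrite -mulrA ler_pM2l //; have := expR_ge0 t; nra.
have := le_normc_shift (rgamma_seq z M) (rgamma_seq z n).
rewrite normc_distC; lra.
Qed.

Lemma rgamma_lim_neq0 z (l : C^o) : (forall k : nat, z <> - k%:R) ->
  rgamma_seq z n @[n --> \oo] --> l -> l != 0.
Proof.
move=> zk ul; have [b b0 [M bM]] := rgamma_seq_lower zk.
rewrite -normc_gt0; have /complex_cvgP/(_ (b / 2)) := ul.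
rewrite divr_gt0 // => /(_ isT)[M' lM].
have H1 := bM (maxn M M') (leq_maxl _ _).
have H2 := lM (maxn M M') (leq_maxr _ _).
have := le_normc_shift (rgamma_seq z (maxn M M')) l.
rewrite normc_distC; lra.
Qed.

(** At the poles of Gamma the sequence is eventually 0. Elsewhere its limit is not
  0, so that inverting it gives the limit defining Gamma. *)
Lemma rgamma_cvg z : rgamma_seq z n @[n --> \oo] --> (rGamma z : C^o).
Proof.
rewrite /rGamma; case: asboolP => [[k ->]|zk].
  apply/complex_cvgP => e e0; exists k => n kn.
  rewrite /rgamma_seq (bigD1 (Ordinal (kn : (k < n.+1)%N))) //=.
  by rewrite addNr !mul0r subrr normc0 ltW.
have {}zk k : z <> - k%:R by move=> zE; apply: zk; exists k.
pose r := 1 + normc z.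
have r1 : 1 <= r by rewrite lerDl normc_ge0.
have zr : normc z <= r by rewrite lerDr.
pose N := (Num.truncn (2 * r)).+1.
have rN : 2 * r <= N%:R by apply/ltW/truncnS_gt.
pose B := normc (rgamma_seq z N) * expR (28 * r ^+ 2 / N%:R) * (28 * r ^+ 2).
have r20 : 0 <= 28 * r ^+ 2 by rewrite mulr_ge0 // sqr_ge0.
have B0 : 0 <= B by rewrite mulr_ge0 // mulr_ge0 ?normc_ge0 ?expR_ge0.
have [l lP] : exists l, forall m, normc (l - rgamma_seq z (m + N)) <= B / m.+1%:R.
  apply: complex_cauchy_limit => m n mn.
  have := rgamma_seq_tail r1 zr rN (m := (m + N)%N) (n := (n + N)%N).
  rewrite leq_addl leq_add2r => /(_ mn) /le_trans; apply.
  rewrite mulrA -/B ler_wpM2l // lef_pV2 ?posrE ?ltr0n ?addn_gt0 ?orbT //.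
  by rewrite ler_nat -addn1 leq_add2l.
have ul : rgamma_seq z n @[n --> \oo] --> (l : C^o).
  apply/complex_cvgP => e e0; exists (Num.truncn (B / e) + N)%N => n Nn.
  have Nn' : (N <= n)%N by apply: leq_trans Nn; exact: leq_addl.
  have := lP (n - N)%N; rewrite subnK // => /le_trans; apply.
  rewrite ler_pdivrMr ?ltr0n // mulrC -ler_pdivrMr //.
  apply/ltW/(lt_le_trans (truncnS_gt _)).
  by rewrite ler_nat ltnS leq_subRL // addnC.
have l0 := rgamma_lim_neq0 zk ul.
have -> : Gamma z = l^-1.
  have Gl : Gamma_seq z n @[n --> \oo] --> (l^-1 : C^o).
    rewrite (_ : Gamma_seq z = fun n => (rgamma_seq z n)^-1).
      exact: cvgV.
    by apply/funext => n; exact: Gamma_seqE.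
  exact: (cvg_lim (@norm_hausdorff C C^o) Gl).
by rewrite invrK.
Qed.

Lemma rGamma_approx z r N m : 1 <= r -> normc z <= r -> 2 * r <= N%:R ->
  (N <= m)%N ->
  normc (rGamma z - rgamma_seq z m) <=
    normc (rgamma_seq z N) * expR (28 * r ^+ 2 / N%:R) * (28 * r ^+ 2 / m%:R).
Proof.
move=> r1 zr rN Nm; apply: (@complex_cvg_bounded _ _ _ _ _ m (@rgamma_cvg z)).
by move=> n mn; apply: rgamma_seq_tail => //; rewrite Nm.
Qed.

Lemma entire_rgamma_seq n : entire (fun z => rgamma_seq z n).
Proof.
pose p : {poly C} := (n`!%:R^-1)%:P * \prod_(k < n.+1) ('X + (k%:R)%:P).
apply: entire_ext (entireM (entire_poly p) (entire_cexp (- (ln n%:R)%:C))) => z.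
rewrite /p hornerM hornerC horner_prod mulrN /rgamma_seq -mulrA [LHS]mulrC.
under eq_bigr do rewrite !hornerE.
by rewrite mulrA [RHS]mulrC [LHS]mulrCA [cexp _ * _]mulrC.
Qed.

Lemma entire_rGamma : entire (@rGamma K).
Proof.
apply: entire_lim => r e e0; pose s := 1 + `|r|.
have s1 : 1 <= s by rewrite lerDl.
pose N := (Num.truncn (2 * s)).+1.
have sN : 2 * s <= N%:R by apply/ltW/truncnS_gt.
have [B B0 rB] := entire_bounded r (entire_rgamma_seq N).
pose A := B * expR (28 * s ^+ 2 / N%:R) * (28 * s ^+ 2).
have s20 : 0 <= 28 * s ^+ 2 by rewrite mulr_ge0 // sqr_ge0.
have A0 : 0 <= A by rewrite mulr_ge0 // mulr_ge0 ?expR_ge0 // ltW.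
pose m := (N + Num.truncn (A / e))%N.
exists (fun z => rgamma_seq z m); first exact: entire_rgamma_seq.
move=> z zr; have zs : normc z <= s.
  by apply: le_trans zr _; apply: le_trans (ler_norm _) _; rewrite lerDr.
apply: le_trans (rGamma_approx s1 zs sN (leq_addr _ _)) _.
have m0 : 0 < m%:R :> K by rewrite ltr0n addn_gt0.
rewrite mulrA ler_pdivrMr // [e * _]mulrC -ler_pdivrMr //.
apply: (@le_trans _ _ (A / e)).
  rewrite ler_pM2r ?invr_gt0 // ler_wpM2r //.
  by rewrite ler_wpM2r ?expR_ge0 // rB.
by apply/ltW/(lt_le_trans (truncnS_gt _)); rewrite ler_nat /m addSn ltnS leq_addl.
Qed.

(** The finite products satisfy the functional equation up to the factor
  1 + (z + 1)/n. *)
Lemma rGamma_shift z : rGamma z = z * rGamma (z + 1).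
Proof.
have H n : (0 < n)%N ->
    z * rgamma_seq (z + 1) n = rgamma_seq z n * (1 + (z + 1) * (n%:R)^-1).
  move=> n0; have n0' : n%:R != 0 :> C by rewrite pnatr_eq0 -lt0n.
  have f0 : n`!%:R != 0 :> C by rewrite pnatr_eq0 -lt0n fact_gt0.
  have -> : 1 + (z + 1) * (n%:R)^-1 = (z + n.+1%:R) * (n%:R)^-1.
    by rewrite -natr1; field.
  have P : z * \prod_(k < n.+1) (z + 1 + k%:R) =
      \prod_(k < n.+1) (z + k%:R) * (z + n.+1%:R).
    rewrite -[RHS](@big_ord_recr _ _ _ n.+1 (fun k => z + k%:R)).
    rewrite [RHS]big_ord_recl /= addr0; congr (_ * _); apply: eq_bigr => k _.
    by rewrite /bump /= add1n -addrA nat1r.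
  have E : cexp (- ((z + 1) * (ln (n%:R : K))%:C)) =
      cexp (- (z * (ln (n%:R : K))%:C)) * (n%:R)^-1.
    rewrite mulrDl mul1r opprD cexpD (cexpN (_%:C)) cexpR.
    by rewrite lnK ?posrE ?ltr0n // rmorph_nat.
  rewrite /rgamma_seq E !mulrA P.
  by move: (\prod_(_ < _) _) (cexp _) (n%:R^-1 : C) (_^-1) => *; ring.
have n1 : 1 + (z + 1) * (n%:R : C)^-1 @[n --> \oo] --> (1 : C^o).
  apply/complex_cvgP => e e0; exists (Num.truncn (normc (z + 1) / e)).+1 => n Nn.
  rewrite opprD addrA subrr sub0r normcN normcM normcV normc_nat.
  rewrite ler_pdivrMr ?ltr0n ?(leq_trans _ Nn) // mulrC -ler_pdivrMr //.
  by apply/ltW/(lt_le_trans (truncnS_gt _)); rewrite ler_nat.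
have L1 : z * rgamma_seq (z + 1) n @[n --> \oo] --> (z * rGamma (z + 1) : C^o).
  exact: (complex_cvgM (cvg_cst (z : C^o)) (@rgamma_cvg (z + 1))).
have L2 := complex_cvgM (@rgamma_cvg z) n1; rewrite mulr1 in L2.
apply/esym; apply: (@cvg_unique _ (@norm_hausdorff C C^o) _ _ _ _ L1).
apply: cvg_trans L2; apply: near_eq_cvg; near=> n.
by rewrite H //; near: n; exact: nbhs_infty_gt.
Unshelve. all: by end_near.
Qed.

End ReciprocalGamma.

(** * Growth and real values of 1/Gamma *)

Section GammaGrowth.
Variable K : realType.
Local Notation C := K[i].
Implicit Types (z w : C) (r x y : K).

Lemma ln_ge1 x : 4 <= x -> 1 <= ln x.
Proof.
move=> x4; have x0 : 0 < x by lra.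
have e2 : expR (1 / 2) <= 2 :> K by exact: expR_le2.
rewrite -ler_expR lnK ?posrE //; apply: le_trans x4.
have -> : expR 1 = expR (1 / 2) * expR (1 / 2) :> K by rewrite -expRD; congr expR; lra.
have -> : 4 = 2 * 2 :> K by ring.
by rewrite ler_pM ?expR_ge0.
Qed.

(** The product is stopped at N of size about 2 r. The partial product is a
  polynomial of degree N + 1 times N ^ (- z), hence at most exp (5 r ln (4 r)), and
  the remaining infinite product is at most 1 + t exp t <= exp (2 t) for
  t = 28 r^2 / N <= 14 r. *)
Lemma rGamma_growth z r : 1 <= r -> normc z <= r ->
  normc (rGamma z) <= expR (33 * (r * ln (4 * r))).
Proof.
move=> r1 zr; set l := ln (4 * r).
have l1 : 1 <= l by apply: ln_ge1; lra.
have r40 : 0 < 4 * r by lra.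
pose N := (Num.truncn (2 * r)).+1.
have rN : 2 * r <= N%:R by apply/ltW/truncnS_gt.
have Nr : N%:R <= 2 * r + 1.
  by rewrite /N -natr1 lerD2r truncn_le; lra.
have N0 : 0 < N%:R :> K by rewrite ltr0n.
have rl : r <= r * l by rewrite ler_peMr //; lra.
have lrg : normc (rgamma_seq z N) <= expR (5 * (r * l)).
  rewrite /rgamma_seq !normcM normcV normc_nat normc_prod normc_cexp.
  apply: (@le_trans _ _ ((4 * r) ^+ N.+1 * expR (r * l))).
    rewrite ler_pdivrMr ?ltr0n ?fact_gt0 //.
    apply: (@le_trans _ _ ((4 * r) ^+ N.+1 * expR (r * l))); last first.
      apply: ler_peMr; last by rewrite ler1n fact_gt0.
      by apply: mulr_ge0; [apply/exprn_ge0/ltW | exact: expR_ge0].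
    rewrite ler_pM ?expR_ge0 ?prodr_ge0 // => [k _||].
    - exact: normc_ge0.
    - have -> : (4 * r) ^+ N.+1 = \prod_(k < N.+1) (4 * r).
        by rewrite prodr_const card_ord.
      apply: ler_prod => k _; rewrite normc_ge0 /=.
      apply: le_trans (le_normcD _ _) _; rewrite normc_nat.
      have kN : k%:R <= N%:R :> K by rewrite ler_nat -ltnS.
      lra.
    rewrite ler_expR; apply: le_trans (ler_norm _) _.
    apply: le_trans (Re_le_normc _) _; rewrite normcN normcM normcR.
    rewrite ler_pM ?normc_ge0 // ger0_norm ?ln_ge0 ?ler1n //.
    by rewrite ler_ln ?posrE //; lra.
  rewrite -(lnK (_ : 4 * r \in Num.pos)) ?posrE // -/l -expRM_natl -expRD ler_expR.
  have : N.+1%:R * l <= (4 * r) * l.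
    by rewrite ler_pM2r; [rewrite -natr1; lra | lra].
  lra.
set t := 28 * r ^+ 2 / N%:R.
have t0 : 0 <= t by rewrite divr_ge0 ?(ltW N0) // mulr_ge0 // sqr_ge0.
have t14 : t <= 14 * r.
  rewrite ler_pdivrMr //.
  have : 14 * r * (2 * r) <= 14 * r * N%:R by rewrite ler_pM2l //; lra.
  by have -> : 14 * r * (2 * r) = 28 * r ^+ 2 by ring.
have := rGamma_approx r1 zr rN (leqnn _); rewrite -/t => H.
apply: le_trans (le_normc_shift _ (rgamma_seq z N)) _.
apply: le_trans (lerD (lexx _) H) _.
apply: (@le_trans _ _ (normc (rgamma_seq z N) * expR (28 * r))).
  rewrite -{1}[normc _]mulr1 -mulrA -mulrDr ler_wpM2l ?normc_ge0 //.
  apply: (@le_trans _ _ (expR t * expR t)); last first.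
    by rewrite -expRD ler_expR; lra.
  have e1 := expR_ge1Dx t.
  have : expR t * (1 + t) <= expR t * expR t by rewrite ler_wpM2l ?expR_ge0.
  lra.
apply: le_trans (ler_wpM2r (expR_ge0 _) lrg) _.
by rewrite -expRD ler_expR; lra.
Qed.

End GammaGrowth.

Section GammaRealAxis.
Variable K : realType.
Local Notation C := K[i].
Implicit Types (r x y : K).

(** The restriction to the real axis, where 1/Gamma is real ([rGamma_real]). *)
Definition rGammaR x : K := complex.Re (rGamma x%:C).

Lemma rgamma_seq_real x n : exists2 t : K, rgamma_seq x%:C n = t%:C & 0 < x -> 0 < t.
Proof.
exists (\prod_(k < n.+1) (x + k%:R) * expR (- (x * ln n%:R)) / n`!%:R).
  rewrite /rgamma_seq -rmorphM -rmorphN cexpR !rmorphM fmorphV rmorph_nat rmorph_prod.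
  by congr (_ * _ / _); apply: eq_bigr => k _; rewrite rmorphD rmorph_nat.
move=> x0; rewrite divr_gt0 ?ltr0n ?fact_gt0 // mulr_gt0 ?expR_gt0 //.
by apply: prodr_gt0 => k _; rewrite ltr_wpDr.
Qed.

Lemma rGamma_real x : rGamma x%:C = (rGammaR x)%:C.
Proof.
suff Im0 : complex.Im (rGamma x%:C) = 0.
  by rewrite /rGammaR; case: (rGamma _) Im0 => a b /= ->.
apply/eqP; rewrite -normr_le0; apply/ler_addgt0Pr => e e0; rewrite add0r.
have /complex_cvgP/(_ e e0)[N /(_ N (leqnn _))] := @rgamma_cvg _ x%:C.
have [t -> _] := rgamma_seq_real x N; apply: le_trans.
apply: le_trans (Im_le_normc _).
by case: (rGamma _) => a b /=; rewrite oppr0 addr0.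
Qed.

Lemma rGammaR_gt0 x : 0 < x -> 0 < rGammaR x.
Proof.
move=> x0; rewrite lt_neqAle eq_sym; apply/andP; split.
  have : rGamma x%:C != 0.
    apply: (rgamma_lim_neq0 _ (@rgamma_cvg _ x%:C)) => k /(congr1 (@complex.Re K)) /=.
    rewrite -[k%:R](rmorph_nat (@real_complex K)) /= => xk.
    by move: x0; rewrite xk oppr_gt0 ltNge ler0n.
  by rewrite rGamma_real -[0]/(0%:C) (inj_eq (@complexI K)).
apply/ler_addgt0Pr => e e0.
have /complex_cvgP/(_ e e0)[N /(_ N (leqnn _))] := @rgamma_cvg _ x%:C.
have [t -> /(_ x0) t0] := rgamma_seq_real x N.
rewrite rGamma_real -rmorphB normcR ler_norml => /andP[H _]; lra.
Qed.

Lemma rGammaR_shift x : rGammaR x = x * rGammaR (x + 1).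
Proof.
apply: complexI; rewrite rmorphM /= -!rGamma_real rGamma_shift.
by rewrite rmorphD rmorph1.
Qed.

Lemma rGammaR_pole (k : nat) : rGammaR (- k%:R) = 0.
Proof.
rewrite /rGammaR /rGamma; case: asboolP => // -[]; exists k.
by rewrite rmorphN rmorph_nat.
Qed.

Lemma rGammaR_continuous : continuous (rGammaR : K -> K).
Proof.
move=> x; apply/cvgrPdist_le => e e0.
have [d d0 H] := entire_continuous x%:C (@entire_rGamma K) e0.
apply/nbhs_ballP; exists d => // y; rewrite /ball /= => xy.
have := H y%:C; rewrite -rmorphB normcR distrC (ltW xy) => /(_ isT).
by rewrite !rGamma_real -rmorphB normcR distrC.
Qed.

(** Two steps of the functional equation multiply the value by a positive factor,
  which is at least 2 from the second time on; so the bound, linear in i, is crude.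
  Moving by 2 keeps the sign. *)
Lemma rGammaR_half (i : nat) :
  3 / 4 * rGammaR (1 / 2) * i.+1%:R <= rGammaR (1 / 2 - (2 * i.+1)%:R).
Proof.
have g0 : 0 < rGammaR (1 / 2) by apply: rGammaR_gt0; lra.
have step j : rGammaR (1 / 2 - (2 * j.+1)%:R) =
    (2 * j%:R + 3 / 2) * (2 * j%:R + 1 / 2) * rGammaR (1 / 2 - (2 * j)%:R).
  rewrite rGammaR_shift (rGammaR_shift (_ + 1)).
  have -> : 1 / 2 - (2 * j.+1)%:R + 1 + 1 = 1 / 2 - (2 * j)%:R :> K.
    by rewrite !natrM -[j.+1%:R]natr1; lra.
  by rewrite !natrM -[j.+1%:R]natr1; field.
elim: i => [|i IH]; rewrite step.
  by rewrite muln0 subr0 mulr1 mulr0 !add0r; lra.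
apply: (@le_trans _ _ (2 * rGammaR (1 / 2 - (2 * i.+1)%:R))).
  have gi := mulr_ge0 (ltW g0) (ler0n K i); move: IH gi.
  rewrite -[i.+2%:R]natr1 -[i.+1%:R]natr1.
  move: (rGammaR (1 / 2)) (rGammaR _) => g G; lra.
rewrite ler_wpM2r //.
  by apply: le_trans IH; rewrite !mulr_ge0 // ltW.
rewrite -[i.+1%:R]natr1; move: (ler0n K i); nra.
Qed.

(** Between - 2 k, where 1/Gamma vanishes, and 1/2 - 2 k, where it is at least 1 for
  large k, the intermediate value theorem applies. *)
Lemma rGamma_solutions : exists k0 : nat, forall y (i : nat), 0 <= y <= 1 ->
  exists2 x, - (2 * (k0 + i)%:R) <= x <= 1 / 2 - 2 * (k0 + i)%:R &
    rGamma x%:C = y%:C.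
Proof.
have g0 : 0 < rGammaR (1 / 2) by apply: rGammaR_gt0; lra.
set c := 3 / 4 * rGammaR (1 / 2).
have c0 : 0 < c by rewrite mulr_gt0 //; lra.
exists (Num.truncn c^-1).+1 => y i /andP[y0 y1]; set k := (_ + i)%N.
have k1 : 1 <= rGammaR (1 / 2 - (2 * k)%:R).
  rewrite /k addSn; apply: le_trans (rGammaR_half _); rewrite -/c.
  rewrite mulrC -ler_pdivrMr // mul1r; apply/ltW/(lt_le_trans (truncnS_gt _)).
  by rewrite ler_nat ltnS leq_addr.
have [|||x] := @IVT K rGammaR (- (2 * k)%:R) (1 / 2 - (2 * k)%:R) y.
- lra.
- by apply: continuous_subspaceT; exact: rGammaR_continuous.
- rewrite rGammaR_pole ge_min le_max y0 /= (le_trans y1 k1) orbT.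
  by [].
rewrite in_itv /= natrM => xk xy; exists x => //.
by rewrite rGamma_real xy.
Qed.

End GammaRealAxis.

(** * Sample points *)

Section ZeroEstimate.
Variable K : realType.
Local Notation C := K[i].
Implicit Types (z w v : C) (P : {poly {poly C}}).

(** The points x j 0, x j 1, ... solve 1/Gamma = j/L in intervals of length 1/2 at
  distance at least 3/2 from each other. For j > L the value 1 replaces j/L,
  so that the points are defined and separated for every j. *)
Lemma sample_points : exists k0 : nat, forall L : nat, (0 < L)%N ->
  exists (x : nat -> nat -> C) (w : nat -> C),
  [/\ forall j i k, i != k -> 1 <= normc (x j i - x j k),
      forall i j, i != j -> L%:R^-1 <= normc (w i - w j),
      forall j, (j <= L)%N -> normc (w j) <= 1,
      forall j i, (j <= L)%N -> rGamma (x j i) = w j &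
      forall j i, normc (x j i) <= 2 * (k0 + i)%:R].
Proof.
have [k0 sol] := rGamma_solutions K; exists k0.+1 => L L0.
have L0' : 0 < L%:R :> K by rewrite ltr0n.
have y01 (j : nat) : 0 <= Num.min 1 (j%:R / L%:R : K) <= 1.
  by rewrite le_min ler01 divr_ge0 // ge_min lexx.
have /choice[x xP] : forall j : nat, exists xj : nat -> K, forall i,
    - (2 * (k0 + i)%:R) <= xj i <= 1 / 2 - 2 * (k0 + i)%:R /\
    rGamma (xj i)%:C = (Num.min 1 (j%:R / L%:R))%:C.
  move=> j; have /choice[xj xjP] : forall i : nat, exists t : K,
      - (2 * (k0 + i)%:R) <= t <= 1 / 2 - 2 * (k0 + i)%:R /\
      rGamma t%:C = (Num.min 1 (j%:R / L%:R))%:C.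
    by move=> i; have [t ti tE] := sol _ i (y01 j); exists t.
  by exists xj.
exists (fun j i => (x j i)%:C), (fun j => (j%:R / L%:R)%:C); split.
- move=> j i k ik; rewrite -rmorphB normcR.
  have xd (a b : nat) : (a < b)%N -> 1 <= x j a - x j b.
    move=> ab; have [/andP[Ha _] _] := xP j a; have [/andP[_ Hb] _] := xP j b.
    rewrite !natrD in Ha Hb.
    have : a%:R + 1 <= b%:R :> K by rewrite natr1 ler_nat.
    lra.
  case: (ltngtP i k) ik => // /xd H _; first exact: le_trans H (ler_norm _).
  by rewrite distrC; exact: le_trans H (ler_norm _).
- move=> i j ij; rewrite -rmorphB normcR -mulrBl normrM.
  rewrite (ger0_norm (_ : 0 <= L%:R^-1)) ?invr_ge0 ?ler0n //.
  rewrite ler_peMl ?invr_ge0 ?ler0n //.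
  have d1 (a b : nat) : (a < b)%N -> 1 <= `|a%:R - b%:R| :> K.
    move=> ab; rewrite distrC; apply: le_trans (ler_norm _).
    by rewrite -natrB ?ler1n ?subn_gt0 // ltnW.
  by case: (ltngtP i j) ij => // /d1; rewrite // distrC.
- move=> j jL; rewrite normcR ger0_norm ?divr_ge0 //.
  by rewrite ler_pdivrMr // mul1r ler_nat.
- move=> j i jL; have [_ ->] := xP j i; congr (_%:C).
  by apply/min_idPr; rewrite ler_pdivrMr // mul1r ler_nat.
- move=> j i; rewrite normcR; have [/andP[H1 H2] _] := xP j i.
  have k0i : 0 <= k0%:R + i%:R :> K by rewrite addr_ge0.
  rewrite addSn -[(k0 + i).+1%:R]natr1; rewrite natrD in H1 H2 *.
  by rewrite ler_norml; apply/andP; split; lra.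
Qed.

(** The sample with the largest value bounds all of them, hence P everywhere by
  interpolation; if it were 0, then P would vanish identically. *)
Lemma eval2_max_sample L P (x : nat -> nat -> C) (w : nat -> C) (k0 : nat) :
  (0 < L)%N -> bidegree_le L P -> P != 0 ->
  (forall j i k, i != k -> 1 <= normc (x j i - x j k)) ->
  (forall i j, i != j -> L%:R^-1 <= normc (w i - w j)) ->
  (forall j, (j <= L)%N -> normc (w j) <= 1) ->
  (forall j i, normc (x j i) <= 2 * (k0 + i)%:R) ->
  exists j i, [/\ (j <= L)%N, (i <= L)%N, 0 < normc (eval2 P (x j i) (w j)) &
    forall z v,
    normc (eval2 P z v) <= L.+1%:R * ((normc v + 1) * L%:R) ^+ L *
      (L.+1%:R * (normc z + 2 * (k0 + L)%:R) ^+ L *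
        normc (eval2 P (x j i) (w j)))].
Proof.
move=> L0 PL P0 x1 wd w1 xk0.
have L0' : 0 < L%:R^-1 :> K by rewrite invr_gt0 ltr0n.
pose V (p : 'I_L.+1 * 'I_L.+1) := normc (eval2 P (x p.1 p.2) (w p.1)).
case: (@arg_maxP _ _ _ (ord0, ord0) xpredT V isT) => -[j i] _ /= Vmax.
have bound z v : normc (eval2 P z v) <= L.+1%:R * ((normc v + 1) * L%:R) ^+ L *
    (L.+1%:R * (normc z + 2 * (k0 + L)%:R) ^+ L * V (j, i)).
  rewrite -[L%:R in X in _ <= X]invrK.
  apply: (eval2_bound PL L0' x1 wd).
  - move=> j' i' _ iL; apply: le_trans (le_normcB _ _) _.
    rewrite lerD2l (le_trans (xk0 _ _)) // ler_pM2l // ler_nat leq_add2l.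
    by [].
  - by move=> j' jL; apply: le_trans (le_normcB _ _) _; rewrite lerD2l w1.
  - move=> j' i' jL iL.
    exact: (Vmax (Ordinal (jL : (j' < L.+1)%N), Ordinal (iL : (i' < L.+1)%N)) isT).
exists j, i; split; [exact: leq_ord | exact: leq_ord | | exact: bound].
rewrite lt_neqAle normc_ge0 andbT eq_sym; apply: contra_neq P0 => V0.
apply: eval2_eq0 => z v; apply/eqP; rewrite -normc_eq0 eq_le normc_ge0 andbT.
by apply: le_trans (bound z v) _; rewrite /V /= V0 !mulr0.
Qed.

End ZeroEstimate.

(** * The zero estimate *)

(** Taking logarithms: every logarithm on the right is O(log (L + R)) except that
  of the bound for 1/Gamma, which is O((L + R) log (L + R)) and occurs L times. *)
Lemma zero_count_of_growth (K : realType) (B : K) : 3 <= B -> exists c : K,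
  forall (L n : nat) (R : K), (0 < L)%N -> 2 <= R ->
  let D := B * (L%:R + R) in
  3 ^+ n <= L.+1%:R * ((expR (33 * (5 * D * ln (4 * (5 * D)))) + 1) * L%:R) ^+ L *
      (L.+1%:R * (6 * D) ^+ L) ->
  n%:R <= c * L%:R * (L%:R + R) * ln (L%:R + R).
Proof.
move=> B3; pose c1 : K := 2 * ln (20 * B) + 1.
exists (2 * (6 + 165 * B * c1 + c1)) => L n R L0 R2 D.
have L1 : 1 <= L%:R :> K by rewrite ler1n.
set S := L%:R + R; have S3 : 3 <= S by rewrite /S; lra.
have S0 : 0 < S by lra.
set l := ln S.
(* 2 ln 3 >= 1 trades the logarithm in base 3 for the factor 2 of the constant *)
have ln9 : 1 <= 2 * ln 3 :> K.
  have -> : 2 * ln 3 = ln (3 ^+ 2) :> K by rewrite lnXn // mulr_natl.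
  by apply: ln_ge1; lra.
have l3 : ln 3 <= l by rewrite ler_ln ?posrE.
have l1 : 1 <= 2 * l by lra.
have D9 : 9 <= D by rewrite /D -/S (_ : 9 = 3 * 3) ?ler_pM //; lra.
have D0 : 0 < D by lra.
have a0 : 0 <= ln (20 * B) by rewrite ln_ge0 //; lra.
have l20 : ln (20 * D) <= c1 * l.
  have -> : 20 * D = 20 * B * S by rewrite /D mulrA.
  rewrite lnM ?posrE // -/l; last by lra.
  have := ler_wpM2l a0 l1; rewrite /c1; lra.
set W := expR _; rewrite -/S => H.
have W1 : 1 <= W.
  rewrite -expR0 ler_expR; apply: mulr_ge0 => //.
  by apply: mulr_ge0; [lra | rewrite ln_ge0 //; lra].
have lnW : ln W = 165 * B * S * ln (20 * D).
  by rewrite /W expRK (_ : 4 * (5 * D) = 20 * D) ?/D -/S; ring.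
have lnWL : ln ((W + 1) * L%:R) <= 1 + ln W + l.
  have -> : 1 + ln W + l = ln (expR 1 * W * S).
    by rewrite !lnM ?posrE ?mulr_gt0 ?expR_gt0 ?expRK.
  rewrite ler_ln ?posrE; last 2 first.
  - by rewrite mulr_gt0; lra.
  - by rewrite !mulr_gt0 ?expR_gt0.
  apply: ler_pM; rewrite ?ler0n ?addr_ge0 ?expR_ge0 //; last by rewrite /S; lra.
  have := ler_wpM2r (expR_ge0 _ : 0 <= W) (expR_ge1Dx (1 : K)); lra.
have ln6 : ln (6 * D) <= c1 * l.
  by apply: le_trans l20; rewrite ler_ln ?posrE; lra.
have lnL1 : ln L.+1%:R <= l.
  by rewrite ler_ln ?posrE ?ltr0n // -natr1 /S; lra.
have WL0 : 0 < (W + 1) * L%:R by rewrite mulr_gt0; lra.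
have : n%:R * ln 3 <= ln L.+1%:R + L%:R * ln ((W + 1) * L%:R) +
    (ln L.+1%:R + L%:R * ln (6 * D)).
  have lnE (a : K) k : 0 < a -> k%:R * ln a = ln (a ^+ k).
    by move=> a0'; rewrite lnXn // mulr_natl.
  rewrite !lnE //; last by lra.
  have L10 : 0 < L.+1%:R :> K by rewrite ltr0n.
  have W'0 := exprn_gt0 L WL0.
  have D'0 : 0 < (6 * D) ^+ L by rewrite exprn_gt0 //; lra.
  have U0 := mulr_gt0 L10 W'0; have V0 := mulr_gt0 L10 D'0.
  by rewrite -!lnM ?posrE // ler_ln ?posrE ?exprn_gt0 // mulr_gt0.
move=> H2.
have {H2} : n%:R <= 2 * (2 * l + L%:R * (1 + ln W + l) + L%:R * (c1 * l)).
  have := ler_wpM2l (ler0n K n) ln9.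
  have := ler_wpM2l (ler0n K L) lnWL.
  have := ler_wpM2l (ler0n K L) ln6.
  lra.
move=> /le_trans; apply.
rewrite -!mulrA ler_pM2l // lnW.
have c10 : 0 <= c1 by rewrite /c1; lra.
have l0 : 0 <= l by lra.
have SL : 1 <= L%:R * S by rewrite -[1]mulr1 ler_pM //; lra.
have E1 : l <= L%:R * (S * l) by rewrite mulrA ler_peMl.
have E2 : L%:R * 1 <= L%:R * (S * (2 * l)).
  by rewrite ler_pM2l; [rewrite -[1]mulr1 ler_pM //; lra | lra].
have E3 : L%:R * l <= L%:R * (S * l).
  by rewrite ler_pM2l; [rewrite ler_peMl //; lra | lra].
have E4 : L%:R * (c1 * l) <= L%:R * (c1 * (S * l)).
  by rewrite ler_pM2l; [rewrite ler_wpM2l // ler_peMl //; lra | lra].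
have E5 : L%:R * (165 * B * S * ln (20 * D)) <= L%:R * (165 * B * S * (c1 * l)).
  rewrite ler_pM2l; last by lra.
  by rewrite ler_wpM2l // mulr_ge0 ?(ltW S0) // mulr_ge0 //; lra.
lra.
Qed.

Theorem mainTheorem2 (K : realType) :
  exists c : K,
    forall (L : nat) (R : K) (P : {poly {poly K[i]}}),
      (1 <= L)%N -> 2 <= R -> P != 0 -> bidegree_le L P ->
      at_most_zeros_in_disc (fun z => eval2 P z (rGamma z)) R
        (c * L%:R * (L%:R + R) * ln (L%:R + R)).
Proof.
have [k0 samples] := sample_points K.
have k00 : 0 <= k0%:R :> K by [].
pose B : K := 2 * k0%:R + 3.
have B3 : 3 <= B by rewrite /B; lra.
(* D = B (L + R) is at least R plus the modulus of every sample point *)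
have [c cP] := zero_count_of_growth B3.
exists c => L R P L0 R2 P0 PL s m us szeros.
have [x [w [x1 wd w1 xw xk0]]] := samples L L0.
have [j [i [jL iL F0 Fbound]]] := eval2_max_sample L0 PL P0 x1 wd w1 xk0.
apply: cP => //; set D := B * (L%:R + R).
have L1 : 1 <= L%:R :> K by rewrite ler1n.
have DL : 2 * k0%:R + 3 * (L%:R + R) <= D.
  have : k0%:R * 1 <= k0%:R * (L%:R + R) by rewrite ler_wpM2l //; lra.
  by rewrite /D /B; lra.
have z0D : normc (x j i) <= 2 * (k0 + L)%:R.
  by apply: le_trans (xk0 j i) _; rewrite ler_pM2l // ler_nat leq_add2l.
rewrite natrD in z0D Fbound.
have D0 : 0 < D by lra.
set W := expR _.
have FE := entire_eval2 P (@entire_rGamma K).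
set N := (\sum_(a <- s) m a)%N.
rewrite -(ler_pM2r F0) -mulrA -[in leRHS]mulrA.
rewrite -{1}(xw j i jL).
apply: (zeros_le_growth (r := R) (D := D) FE us) => //; last 2 first.
- lra.
- move=> z zD.
  have z5 : normc z <= 5 * D.
    by apply: le_trans (le_normc_shift z (x j i)) _; lra.
  apply: le_trans (Fbound z (rGamma z)) _.
  have GW : normc (rGamma z) <= W by apply: rGamma_growth; lra.
  have G0 := normc_ge0 (rGamma z); have z0 := normc_ge0 z.
  have leX (a b : K) : 0 <= a -> a <= b -> a ^+ L <= b ^+ L.
    by move=> a0 ab; rewrite lerXn2r ?nnegrE // (le_trans a0).
  have GL : ((normc (rGamma z) + 1) * L%:R) ^+ L <= ((W + 1) * L%:R) ^+ L.
    by apply: leX; [rewrite mulr_ge0 //; lra | rewrite ler_wpM2r //; lra].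
  have zL : (normc z + 2 * (k0%:R + L%:R)) ^+ L <= (6 * D) ^+ L.
    by apply: leX; lra.
  have -> : L.+1%:R * (((W + 1) * L%:R) ^+ L * (L.+1%:R * (6 * D) ^+ L) *
      normc (eval2 P (x j i) (w j))) = L.+1%:R * ((W + 1) * L%:R) ^+ L *
      (L.+1%:R * (6 * D) ^+ L * normc (eval2 P (x j i) (w j))).
    by rewrite !mulrA.
  have Lx (a b : K) : a <= b -> L.+1%:R * a <= L.+1%:R * b.
    by rewrite ler_pM2l ?ltr0n.
  apply: ler_pM; [| | exact: Lx | by rewrite ler_pM2r // Lx].
    by rewrite mulr_ge0 // exprn_ge0 // mulr_ge0 //; lra.
  by rewrite mulr_ge0 ?normc_ge0 // mulr_ge0 // exprn_ge0 //; lra.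
move=> a /szeros[ar /vanishes_to_order_ge am]; split => //.
by rewrite -lecR -normcE.
Qed.
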